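(* Let $N\ge 3$ and let $\rho:[0,\infty)\to[0,\infty)$ be a weight with $\rho\in L^1_{\mathrm{loc}}(0,\infty)$ satisfying $(1+s)^\gamma\le \rho(s)\le (1+s)^\beta$ for all $s\ge 0$, for some constants $0<\gamma<\beta$. Then $$S_{2_\ast,\mathbb{R}^{N-1}}:=\inf_{u\in \mathcal{D}^{1,2}_\rho(\mathbb{R}^N_+)\setminus\{0\}}\frac{\int_{\mathbb{R}^N_+}\rho(x_N)|\nabla u|^2\,dx}{\left(\int_{\mathbb{R}^{N-1}}|u|^{2_\ast}\,dx'\right)^{2/2_\ast}}=S_\partial ,$$ and the infimum $S_{2_\ast,\mathbb{R}^{N-1}}$ is not achieved by any $u\in \mathcal{D}^{1,2}_\rho(\mathbb{R}^N_+)\setminus\{0\}$.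
   Context: $\mathbb{R}^N_+=\{x=(x',x_N): x'\in\mathbb{R}^{N-1},\ x_N>0\}$, with boundary identified with $\mathbb{R}^{N-1}$; integrals over $\mathbb{R}^{N-1}$ of functions on $\mathbb{R}^N_+$ involve their traces. $2_\ast=2(N-1)/(N-2)$. $C^\infty_\delta(\mathbb{R}^N_+)$ is the set of restrictions to $\mathbb{R}^N_+$ of functions in $C_0^\infty(\mathbb{R}^N)$. $\mathcal{D}^{1,2}_\rho(\mathbb{R}^N_+)$ is the closure of $C^\infty_\delta(\mathbb{R}^N_+)$ with respect to the norm $\|u\|=\left(\int_{\mathbb{R}^N_+}\rho(x_N)|\nabla u|^2dx\right)^{1/2}$, and $\mathcal{D}^{1,2}(\mathbb{R}^N_+)$ is the same space with $\rho\equiv1$. $S_\partial$ is the best constant of the classical Sobolev trace inequality: $$S_\partial=\inf_{u\in\mathcal{D}^{1,2}(\mathbb{R}^N_+)\setminus\{0\}}\frac{\int_{\mathbb{R}^N_+}|\nabla u|^2dx}{\left(\int_{\mathbb{R}^{N-1}}|u|^{2_\ast}dx'\right)^{2/2_\ast}}.$$ Quotients with zero denominator are regarded as $+\infty$. *)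

(* Defs.v *)
From HB Require Import structures.
From mathcomp Require Import all_boot all_order all_algebra.
From mathcomp Require Import all_classical all_reals all_analysis measurable_realfun.
Set Implicit Arguments.
Unset Strict Implicit.
Unset Printing Implicit Defensive.
Import Order.TTheory GRing.Theory Num.Theory.
Import numFieldNormedType.Exports.
Local Open Scope classical_set_scope.
Local Open Scope ring_scope.

(* R^n is 'rV[R]_n with the product sigma-algebra (which is its Borel
   sigma-algebra), as for n.-tuple in the library. *)
Definition rV_display : measure_display -> measure_display.
Proof. exact. Qed.

Section rV_measurable.
Context {d : measure_display} {T : sigmaRingType d} (n : nat).
Let coors (i : 'I_n) (x : 'rV[T]_n) : T := x ord0 i.

Let rV_set0 : g_sigma_preimage coors set0.
Proof. exact: sigma_algebra0. Qed.
Let rV_setC A : g_sigma_preimage coors A -> g_sigma_preimage coors (~` A).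
Proof. exact: sigma_algebraC. Qed.
Let rV_bigcup (F : (set 'rV[T]_n)^nat) :
  (forall i, g_sigma_preimage coors (F i)) ->
  g_sigma_preimage coors (\bigcup_i F i).
Proof. exact: sigma_algebra_bigcup. Qed.

HB.instance Definition _ := @isMeasurable.Build (rV_display d)
  'rV[T]_n (g_sigma_preimage coors) rV_set0 rV_setC rV_bigcup.
End rV_measurable.

(* The library's sigma-finiteness instance of a product measure is not found by
   inference from a {sigma_finite_measure _} expected type. *)
Lemma sigma_finite_prod d1 d2 (T1 : measurableType d1) (T2 : measurableType d2)
    (R : realType) (m1 : {sigma_finite_measure set T1 -> \bar R})
    (m2 : {sigma_finite_measure set T2 -> \bar R}) :
  sigma_finite [set: T1 * T2] (m1 \x m2)%E.
Proof.
have /sigma_finiteP[F [TF ndF Foo]] := sigma_finiteT m1.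
have /sigma_finiteP[G [TG ndG Goo]] := sigma_finiteT m2.
exists (fun n => F n `*` G n).
  rewrite -setXTT TF TG predeqE => -[x y]; split.
    move=> [/= [n _ Fnx] [k _ Gky]]; exists (maxn n k) => //; split.
    - by move: x Fnx; exact/subsetPset/ndF/leq_maxl.
    - by move: y Gky; exact/subsetPset/ndG/leq_maxr.
  by move=> [n _ []/= ? ?]; split; exists n.
move=> k; have [? ?] := Foo k; have [? ?] := Goo k.
split; first exact: measurableX.
by rewrite product_measure1E// lte_mul_pinfty// ge0_fin_numE.
Qed.

Section rV_cons.
Context {R : realType} (n : nat).

Definition rV_cons (tx : R * 'rV[R]_n) : 'rV[R]_n.+1 :=
  \row_i oapp (tx.2 ord0) tx.1 (unlift ord0 i).

Lemma measurable_rV_coord m (i : 'I_m) :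
  measurable_fun [set: 'rV[R]_m] (fun x : 'rV[R]_m => x ord0 i).
Proof.
move=> _ Y mY; rewrite setTI; apply: sub_sigma_algebra => /=.
rewrite -bigcup_seq/=; exists i => /=; first by rewrite mem_index_enum.
by exists Y => //; rewrite setTI.
Qed.

Lemma measurable_fun_rV d (T : measurableType d) m (f : T -> 'rV[R]_m) :
  (forall i, measurable_fun [set: T] (fun x => f x ord0 i)) ->
  measurable_fun [set: T] f.
Proof.
move=> mf _ Y mY; rewrite setTI.
suff: <<s \big[setU/set0]_(i < m) preimage_set_system setT
    (fun x : 'rV[R]_m => x ord0 i) measurable >> `<=`
    [set A | measurable (f @^-1` A)] by move/(_ Y mY).
apply: smallest_sub; first split => /=.
- by rewrite preimage_set0.
- by move=> A mA; rewrite setTD preimage_setC; exact: measurableC.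
- by move=> F mF; rewrite preimage_bigcup; exact: bigcupT_measurable.
move=> A; rewrite -bigcup_seq => -[i _] [B mB <-] /=.
by rewrite setTI -comp_preimage -[X in measurable X]setTI; exact: mf.
Qed.

Lemma measurable_rV_cons : measurable_fun [set: R * 'rV[R]_n] rV_cons.
Proof.
apply: measurable_fun_rV => i; rewrite /rV_cons.
under eq_fun do rewrite mxE.
case: (unliftP ord0 i) => [j _|_] /=; last exact: measurable_fst.
exact: (measurableT_comp (measurable_rV_coord j) measurable_snd).
Qed.

Definition rV_uncons (x : 'rV[R]_n.+1) : R * 'rV[R]_n :=
  (x ord0 ord0, \row_j x ord0 (lift ord0 j)).

Lemma rV_consK : cancel rV_cons rV_uncons.
Proof.
case=> t x; rewrite /rV_uncons /rV_cons mxE unlift_none /=; congr pair.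
by apply/rowP => j; rewrite !mxE liftK.
Qed.

Lemma measurable_rV_uncons : measurable_fun [set: 'rV[R]_n.+1] rV_uncons.
Proof.
apply/measurable_fun_pairP; split; first exact: measurable_rV_coord.
apply: measurable_fun_rV => j /=.
under eq_fun do rewrite mxE.
exact: measurable_rV_coord.
Qed.

Variable m : {sigma_finite_measure set 'rV[R]_n -> \bar R}.

Definition rV_cons_measure : set 'rV[R]_n.+1 -> \bar R :=
  pushforward (@lebesgue_measure R \x m)%E rV_cons.

Let rV_cons_measurable A : measurable A -> measurable (rV_cons @^-1` A).
Proof.
by move=> mA; rewrite -[X in measurable X]setTI; exact: measurable_rV_cons.
Qed.

Let rV_cons_measure0 : rV_cons_measure set0 = 0%E.
Proof. by rewrite /rV_cons_measure /pushforward preimage_set0 measure0. Qed.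

Let rV_cons_measure_ge0 A : (0 <= rV_cons_measure A)%E.
Proof. by rewrite /rV_cons_measure /pushforward measure_ge0. Qed.

Let rV_cons_measure_sigma_additive : semi_sigma_additive rV_cons_measure.
Proof.
move=> F mF tF mUF; rewrite /rV_cons_measure /pushforward preimage_bigcup.
apply: measure_semi_sigma_additive.
- by move=> k; exact: rV_cons_measurable.
- apply/trivIsetP => /= i j _ _ ij; rewrite -preimage_setI.
  by move/trivIsetP : tF => /(_ _ _ _ _ ij) ->//; rewrite preimage_set0.
- by rewrite -preimage_bigcup; exact: rV_cons_measurable.
Qed.

HB.instance Definition _ := isMeasure.Build _ _ _ rV_cons_measure
  rV_cons_measure0 rV_cons_measure_ge0 rV_cons_measure_sigma_additive.

Let rV_cons_measure_sigma_finite : sigma_finite setT rV_cons_measure.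
Proof.
have [F TF Foo] := sigma_finite_prod (@lebesgue_measure R) m.
exists (fun k => rV_uncons @^-1` F k).
  by rewrite -preimage_bigcup -TF preimage_setT.
move=> k; have [mFk Fkoo] := Foo k; split.
  by rewrite -[X in measurable X]setTI; exact: measurable_rV_uncons.
rewrite /rV_cons_measure /pushforward -comp_preimage.
rewrite (_ : rV_uncons \o rV_cons = id)//.
by apply/funext => x /=; rewrite rV_consK.
Qed.

HB.instance Definition _ := Measure_isSigmaFinite.Build _ _ _ rV_cons_measure
  rV_cons_measure_sigma_finite.
End rV_cons.

(* Lebesgue measure on R^n, as an iterated product. *)
Fixpoint rV_lebesgue {R : realType} (n : nat) :
    {sigma_finite_measure set 'rV[R]_n -> \bar R} :=
  match n with
  | 0 => \d_(0 : 'rV[R]_0)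
  | n'.+1 => rV_cons_measure (rV_lebesgue n')
  end.

(* A point of R^N is a pair x = (x', x_N) with x' in R^(N-1). *)
Section half_space.
Context {R : realType} (N : nat).
Local Notation RN := ('rV[R]_N.-1 * R)%type.

Definition space_lebesgue :
    {measure set ('rV[R]_N.-1 * measurableTypeR R)%type -> \bar R} :=
  (rV_lebesgue N.-1 \x @lebesgue_measure R)%E.

Definition half_space : set RN := [set x | 0 < x.2].

(* The N coordinate directions: Some j for the j-th coordinate of x', None for
   x_N. *)
Definition coord_dir (i : option 'I_N.-1) : RN :=
  if i is Some j then (delta_mx ord0 j, 0) else (0, 1).

Definition partial (i : option 'I_N.-1) (f : RN -> R) : RN -> R :=
  fun x => 'D_(coord_dir i) f x.

Fixpoint Ck (k : nat) (f : RN -> R) : Prop :=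
  continuous f /\
  if k is k'.+1 then
    forall i, (forall x, derivable f x (coord_dir i)) /\ Ck k' (partial i f)
  else True.

Definition closed_support (f : RN -> R) : set RN := closure [set x | f x != 0].

(* C_0^oo(R^N).  An element of C^oo_delta(R^N_+) is the restriction of such a
   function to the half-space. *)
Definition test_function (f : RN -> R) : Prop :=
  (forall k, Ck k f) /\ compact (closed_support f).

Definition locally_integrable_half (f : RN -> R) : Prop :=
  measurable_fun half_space f /\
  forall K : set RN, compact K -> K `<=` half_space ->
    (\int[space_lebesgue]_(x in K) `|f x|%:E < +oo)%E.

Definition weak_gradient (u : RN -> R) (G : option 'I_N.-1 -> RN -> R) : Prop :=
  [/\ locally_integrable_half u,
      forall i, locally_integrable_half (G i) &
      forall i psi, test_function psi -> closed_support psi `<=` half_space ->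
        (\int[space_lebesgue]_(x in half_space) (u x * partial i psi x)%:E =
         - \int[space_lebesgue]_(x in half_space) (G i x * psi x)%:E)%E].

Definition energy (rho : R -> R) (G : option 'I_N.-1 -> RN -> R) : \bar R :=
  (\int[space_lebesgue]_(x in half_space)
     (rho x.2 * \sum_i G i x ^+ 2)%:E)%E.

(* phi_k in C^oo_delta converges to u, of weak gradient G, in the norm of
   D^{1,2}_rho.  That norm does not see additive constants: the L^1_loc
   convergence selects the function u which represents the limit.  It is no
   restriction when N >= 3 and rho >= 1, as a sequence of C^oo_delta which is
   Cauchy in the norm is then Cauchy in L^1_loc by the Sobolev inequality.
   (`|x| is the sup norm of R^N.) *)
Definition approximates (rho : R -> R) (phi : nat -> RN -> R)
    (u : RN -> R) (G : option 'I_N.-1 -> RN -> R) : Prop :=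
  [/\ forall k, test_function (phi k),
      forall r : R,
        (\int[space_lebesgue]_(x in half_space `&` [set x | (`|x| < r)%R])
           `|phi k x - u x|%:E)%E @[k --> \oo] --> 0%E &
      energy rho (fun i x => partial i (phi k) x - G i x) @[k --> \oo] --> 0%E].

(* D^{1,2}_rho(R^N_+): functions with their weak gradient, up to equality almost
   everywhere on the half-space. *)
Record D12 (rho : R -> R) := MkD12 {
  D12_fun :> RN -> R;
  D12_grad : option 'I_N.-1 -> RN -> R;
  D12_weak_gradient : weak_gradient D12_fun D12_grad;
  D12_closure : exists phi, approximates rho phi D12_fun D12_grad }.

Definition D12_nonzero (rho : R -> R) (u : D12 rho) : Prop :=
  ~ {ae space_lebesgue, forall x, half_space x -> u x = 0}.

(* 2_* = 2 (N - 1) / (N - 2) *)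
Definition trace_exponent : R := 2 * (N%:R - 1) / (N%:R - 2).

Definition boundary_integral (T : 'rV[R]_N.-1 -> R) : \bar R :=
  (\int[rV_lebesgue N.-1]_x (`|T x| `^ trace_exponent)%:E)%E.

(* The trace operator D^{1,2}_rho(R^N_+) -> L^{2_*}(R^(N-1)) is the continuous
   extension of phi |-> phi(., 0); by the Sobolev trace inequality every u has a
   trace, unique up to equality almost everywhere. *)
Definition is_trace (rho : R -> R) (u : D12 rho) (T : 'rV[R]_N.-1 -> R) : Prop :=
  measurable_fun [set: 'rV[R]_N.-1] T /\
  exists phi, approximates rho phi u (D12_grad u) /\
    boundary_integral (fun x => phi k (x, 0) - T x) @[k --> \oo] --> 0%E.

(* The library has 0 * 0^-1 = 0 in \bar R, hence the case distinction. *)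
Definition trace_quotient (rho : R -> R) (u : D12 rho) (T : 'rV[R]_N.-1 -> R) :
    \bar R :=
  if boundary_integral T == 0%E then +oo%E
  else (energy rho (D12_grad u) /
        poweR (boundary_integral T) (2 / trace_exponent))%E.

(* S_{2_*, R^(N-1)} for the weight rho *)
Definition trace_constant (rho : R -> R) : \bar R :=
  ereal_inf [set q | exists (u : D12 rho) (T : 'rV[R]_N.-1 -> R),
    [/\ D12_nonzero u, is_trace u T & q = trace_quotient u T]].

Definition sobolev_trace_constant : \bar R := trace_constant (fun=> 1).

End half_space.

(* Main.v *)
Require Import Defs.
From mathcomp Require Import all_boot all_order all_algebra.
From mathcomp Require Import all_classical all_reals all_analysis measurable_realfun.
From mathcomp Require Import ring lra.
Set Implicit Arguments.
Unset Strict Implicit.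
Unset Printing Implicit Defensive.
Import Order.TTheory GRing.Theory Num.Theory.
Import numFieldNormedType.Exports.
Local Open Scope classical_set_scope.
Local Open Scope ring_scope.

(* Since rho >= 1, the weighted space embeds in the unweighted one with smaller
   quotients, so S_partial is at most the weighted infimum.  Conversely the
   unweighted quotient of a test function phi is invariant under the dilations
   phi (a x), whose supports shrink to the boundary as a grows, where rho is
   close to 1.  If the weighted infimum were attained at u, then both energies of
   u would agree, and grad u = 0 because rho > 1 inside the half-space.  Hardy's
   inequality then makes the approximating test functions tend to 0 in L^2_loc,
   so u = 0.  Hardy's inequality and the integration by parts both come from the
   translation invariance of Lebesgue measure, applied to difference quotients;
   finiteness of the infimum needs one test function with nonzero trace, which
   is a vertical translate of an approximation of a nonzero u. *)

(** * Affine maps and open sets for Lebesgue measure on R^n *)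

(** Only test functions are dilated: compact support is what makes [rho] uniformly close to 1 after
    shrinking. The resulting bound of the unweighted energy by the weighted constant is then carried
    to every element of the unweighted space by an approximation argument with explicit errors. The
    constant is an extended real, and its finiteness matters twice: the passage to the limit
    multiplies by a real constant, and an element of zero trace has quotient +oo, hence would attain
    an infinite infimum. A zero gradient alone does not force u = 0, as constants show. What
    excludes them is the approximation by compactly supported functions, and Hardy's inequality with
    a weight bounded below on bounded sets extracts this information. *)

Definition scales_measure {R : realType} {d} {T : measurableType d}
    (m : {measure set T -> \bar R}) (f : T -> T) (c : R) :=
  measurable_fun [set: T] f /\
  forall A, measurable A -> m (f @^-1` A) = (c%:E * m A)%E.

(** By uniqueness of Lebesgue measure: [a] times its image under the map agrees with it on half-open
    intervals. *)
Lemma scales_lebesgue {R : realType} (a v : R) : 0 < a ->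
  scales_measure (@lebesgue_measure R) (fun t => a * t + v) a^-1.
Proof.
move=> a0.
have mf : measurable_fun [set: R] (fun t : R => a * t + v).
  by apply: measurable_funD => //; exact: measurable_funM.
split=> // A mA.
pose f : measurableTypeR R -> measurableTypeR R := fun t => a * t + v.
have mf' : measurable_fun [set: measurableTypeR R] f by exact: mf.
have a0' : 0 <= a by exact: ltW.
pose m : {measure set (measurableTypeR R) -> \bar R} :=
  mscale (NngNum a0')
    (measure_function_pushforward__canonical__measure_function_Measure
      (@lebesgue_measure R) mf').
suff E : lebesgue_measure A = m A.
  rewrite [X in (_ * X)%E]E.
  rewrite (_ : m _ = a%:E * @lebesgue_measure R (f @^-1` A))%E//.
  by rewrite muleA -EFinM mulVf ?mul1e// gt_eqF.
apply: lebesgue_measure_unique => // _ [[x y] _ <-] /=.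
rewrite (_ : m _ = a%:E * @lebesgue_measure R (f @^-1` `]x, y]))%E//.
have ->: f @^-1` `]x, y] = `](x - v) / a, (y - v) / a]%classic.
  apply/seteqP; split => t /=; rewrite !in_itv/= /f.
    by rewrite ltr_pdivrMr// ler_pdivlMr// ltrBlDr lerBrDr mulrC.
  by rewrite ltr_pdivrMr// ler_pdivlMr// ltrBlDr lerBrDr mulrC.
rewrite !lebesgue_measure_itv/= !lte_fin.
rewrite ltr_pM2r ?invr_gt0// ltrBlDr subrK.
case: ifPn => xy; last by rewrite mule0.
rewrite -!EFinB -EFinM; congr EFin; field; exact: lt0r_neq0.
Qed.

Section scales_prod.
Context {R : realType} d1 d2 (T1 : measurableType d1) (T2 : measurableType d2).
Variables (m1 : {sigma_finite_measure set T1 -> \bar R})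
          (m2 : {sigma_finite_measure set T2 -> \bar R}).

(** By uniqueness of the product measure: the image measure divided by [c1 * c2] has the right value
    on rectangles. *)
Lemma scales_prod f1 f2 (c1 c2 : R) : 0 < c1 -> 0 < c2 ->
  scales_measure m1 f1 c1 -> scales_measure m2 f2 c2 ->
  scales_measure (m1 \x m2)%E (fun x => (f1 x.1, f2 x.2)) (c1 * c2).
Proof.
move=> c10 c20 [mf1 s1] [mf2 s2].
pose f (x : T1 * T2) := (f1 x.1, f2 x.2).
have mf : measurable_fun [set: T1 * T2] f.
  apply/measurable_fun_pairP; split.
    exact: (measurableT_comp mf1 measurable_fst).
  exact: (measurableT_comp mf2 measurable_snd).
split=> // A mA.
have c0 : 0 <= (c1 * c2)^-1 by rewrite invr_ge0 mulr_ge0// ltW.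
have cn : c1 * c2 != 0 by rewrite mulf_neq0// gt_eqF.
pose m : {measure set (T1 * T2) -> \bar R} :=
  mscale (NngNum c0)
    (measure_function_pushforward__canonical__measure_function_Measure
      (m1 \x m2)%E mf).
suff E : (m1 \x m2)%E A = m A.
  rewrite [X in (_ * X)%E]E (_ : m _ = (c1 * c2)^-1%:E * (m1 \x m2) (f @^-1` A))%E//.
  by rewrite muleA -EFinM mulfV ?mul1e.
apply: product_measure_unique => // B C mB mC.
rewrite (_ : m _ = (c1 * c2)^-1%:E * (m1 \x m2) (f @^-1` (B `*` C)))%E//.
have -> : f @^-1` (B `*` C) = (f1 @^-1` B) `*` (f2 @^-1` C) by [].
rewrite product_measure1E//.
- rewrite s1// s2// [X in (_ * X)%E]muleACA.
  rewrite (_ : c1%:E * c2%:E = (c1 * c2)%:E)%E// [LHS]muleA -EFinM mulVf//.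
  by rewrite mul1e.
- by rewrite -[X in measurable X]setTI; exact: mf1.
- by rewrite -[X in measurable X]setTI; exact: mf2.
Qed.
End scales_prod.

(** The map acts coordinatewise, so through [rV_cons] it becomes a product of a one-dimensional map
    and the same kind of map in dimension [n]; [scales_prod] gives the induction step. *)
Lemma scales_rV_lebesgue {R : realType} n (a : R) (v : 'rV[R]_n) : 0 < a ->
  scales_measure (rV_lebesgue n) (fun x : 'rV[R]_n => a *: x + v) (a ^- n).
Proof.
move=> a0; have mf k (w : 'rV[R]_k) : measurable_fun [set: 'rV[R]_k]
    (fun x : 'rV[R]_k => a *: x + w).
  apply: measurable_fun_rV => i; under eq_fun do rewrite !mxE.
  by apply: measurable_funD => //; apply: measurable_funM => //;
    exact: measurable_rV_coord.
split; first exact: mf.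
elim: n v => [|n IH] v A mA.
  rewrite expr0 invr1 mul1e /=; congr (\d_ _ _).
  have -> : (fun x : 'rV_0 => a *: x + v) = id by apply/funext => x; apply/rowP => -[].
  by [].
rewrite /= /rV_cons_measure /pushforward -comp_preimage.
pose G (x : R * 'rV[R]_n) := (a * x.1 + v ord0 ord0, a *: x.2 + (rV_uncons v).2).
have -> : (fun x => a *: x + v) \o @rV_cons R n = @rV_cons R n \o G.
  apply/funext => x; apply/rowP => i; rewrite /rV_cons /G /= !mxE.
  by case: unliftP => [j ->|->]/=; rewrite ?mxE.
have [mG sG] : scales_measure (@lebesgue_measure R \x rV_lebesgue n)%E G
    (a^-1 * a ^- n).
  apply: (scales_prod (m1 := @lebesgue_measure R) (m2 := rV_lebesgue n)
    (f1 := fun t => a * t + v ord0 ord0)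
    (f2 := fun x => a *: x + (rV_uncons v).2)).
  - by rewrite invr_gt0.
  - by rewrite invr_gt0 exprn_gt0.
  - exact: scales_lebesgue.
  - by split=> [|B mB]; [exact: mf|exact: IH].
rewrite comp_preimage sG; last first.
  by rewrite -[X in measurable X]setTI; exact: measurable_rV_cons.
by rewrite exprS invfM.
Qed.

Section integral_scales.
Context {R : realType} d (T : measurableType d) (m : {measure set T -> \bar R}).
Variables (f : T -> T) (c : R).
Hypotheses (c0 : 0 < c) (mfc : scales_measure m f c).
Local Open Scope ereal_scope.

Lemma ge0_integral_scales D (g : T -> \bar R) :
  measurable D -> measurable_fun D g -> (forall x, D x -> 0 <= g x) ->
  \int[m]_(x in f @^-1` D) g (f x) = c%:E * \int[m]_(x in D) g x.
Proof.
move=> mD mg g0; have [mf sf] := mfc.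
have c0' : (0 <= c)%R by exact: ltW.
rewrite -[RHS](@ge0_integral_mscale _ _ _ m _ mD (NngNum c0') g mg g0).
rewrite -[LHS](ge0_integral_pushforward mf m mD mg); last first.
  by move=> x /[!inE]; exact: g0.
by apply: eq_measure_integral => A mA _; exact: sf.
Qed.
End integral_scales.

(** Meant for translations, with integrands of any sign: positive and negative parts are transported
    separately. *)
Lemma integral_scales1 {R : realType} d (T : measurableType d)
    (m : {measure set T -> \bar R}) (f : T -> T) D (g : T -> \bar R) :
  scales_measure m f 1 -> measurable D -> measurable_fun D g ->
  (\int[m]_(x in f @^-1` D) g (f x) = \int[m]_(x in D) g x)%E.
Proof.
move=> sf mD mg; rewrite integralE [RHS]integralE.
rewrite -[in RHS](mul1e (\int[m]_(x in D) g^\+ x)%E).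
rewrite -[in RHS](mul1e (\int[m]_(x in D) g^\- x)%E).
rewrite -!(ge0_integral_scales (ltr01 : 0 < 1 :> R) sf)//.
- by congr (_ - _)%E; apply: eq_integral => x _; rewrite ?funeposE ?funenegE.
- exact: measurable_funeneg.
- exact: measurable_funepos.
Qed.

Section space.
Context {R : realType} (N : nat).
Local Notation RN := ('rV[R]_N.-1 * R)%type.
Local Notation mu := (@space_lebesgue R N).

Lemma scales_space_lebesgue (a : R) (v : RN) : 0 < a ->
  scales_measure mu (fun x : RN => a *: x + v) (a ^- N.-1 * a^-1).
Proof.
move=> a0; have := scales_prod _ _ (scales_rV_lebesgue v.1 a0)
  (scales_lebesgue v.2 a0).
by rewrite invr_gt0 exprn_gt0// invr_gt0; apply.
Qed.

Lemma scales_translation (v : RN) : scales_measure mu (fun x : RN => x + v) 1.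
Proof.
have := scales_space_lebesgue v ltr01.
rewrite expr1n invr1 mul1r.
by rewrite (_ : (fun x => 1 *: x + v) = (fun x : RN => x + v))//;
  apply/funext => x; rewrite scale1r.
Qed.

Lemma scales_dilation (a : R) : 0 < a ->
  scales_measure mu (fun x : RN => a *: x) (a ^- N.-1 * a^-1).
Proof.
move=> /(scales_space_lebesgue 0).
by rewrite (_ : (fun x => a *: x + 0) = (fun x : RN => a *: x))//;
  apply/funext => x; rewrite addr0.
Qed.

Lemma measurable_half_space :
  measurable (@half_space R N : set ('rV[R]_N.-1 * measurableTypeR R)).
Proof.
rewrite (_ : @half_space R N = snd @^-1` `]0, +oo[%classic); last first.
  by apply/seteqP; split => x /=; rewrite /half_space/= in_itv/= andbT.
by rewrite -[X in measurable X]setTI; exact: measurable_snd.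
Qed.

Lemma mule_pos_fin (x y : \bar R) :
  (0 < x < +oo -> 0 < y < +oo -> 0 < x * y < +oo)%E.
Proof.
move=> /andP[x0 xoo] /andP[y0 yoo]; rewrite mule_gt0//=.
by rewrite lte_mul_pinfty ?ltW// ge0_fin_numE// ltW.
Qed.

Lemma lebesgue_ball_pos (x : R) r : 0 < r ->
  (0 < @lebesgue_measure R (ball x r) < +oo)%E.
Proof.
move=> r0; rewrite lebesgue_measure_ball ?ltW// ltry andbT.
by rewrite lte_fin pmulrn_lgt0.
Qed.

(** Balls of the sup norm are cubes, so [rV_cons] pulls a ball back to an interval times a ball of
    one dimension less. *)
Lemma ball_rV_measure n (x : 'rV[R]_n) r : 0 < r ->
  measurable (ball x r) /\ (0 < rV_lebesgue n (ball x r) < +oo)%E.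
Proof.
move=> r0.
have mb k (y : 'rV[R]_k) : measurable (ball y r).
  rewrite (_ : ball y r = \big[setI/setT]_(i < k)
    ((fun z : 'rV[R]_k => z ord0 i) @^-1` (ball (y ord0 i) r : set R))).
    apply: bigsetI_measurable => i _; rewrite -[X in measurable X]setTI.
    by apply: measurable_rV_coord => //; exact: measurable_ball.
  apply/seteqP; split => z.
    by move=> [_ yz]; rewrite -bigcap_seq => i _ /=; exact: yz.
  rewrite -bigcap_seq => yz; split => // i j; rewrite (ord1 i).
  by apply: yz; rewrite /= mem_index_enum.
split => //; elim: n x => [|n IH] x.
  rewrite /= diracE mem_set ?lte01 ?ltry//; split => // i [].
  by case.
have E : @rV_cons R n @^-1` ball x r =
    ball (x ord0 ord0) r `*` ball ((rV_uncons x).2) r.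
  apply/seteqP; split => -[t y] /=.
    move=> [_ xy]; split.
      by have := xy ord0 ord0; rewrite /rV_cons mxE unlift_none.
    split => // i j; rewrite (ord1 i).
    by have := xy ord0 (lift ord0 j); rewrite !mxE liftK.
  move=> [xt [_ xy]]; split => // i j; rewrite (ord1 i) /rV_cons mxE.
  case: (unliftP ord0 j) => [k ->|->] //=.
  by have := xy ord0 k; rewrite !mxE.
rewrite /= /rV_cons_measure /pushforward E product_measure1E//; last first.
- exact: mb.
- exact: measurable_ball.
exact: mule_pos_fin (lebesgue_ball_pos _ r0) (IH _).
Qed.

Lemma ball_space_measure (x : RN) r : 0 < r ->
  measurable (ball x r) /\ (0 < mu (ball x r) < +oo)%E.
Proof.
move=> r0; have [mb /andP[b0 boo]] := ball_rV_measure x.1 r0.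
rewrite (_ : ball x r = ball x.1 r `*` ball x.2 r)//.
have mb2 : measurable (ball x.2 r : set R) by exact: measurable_ball.
split; first exact: measurableX.
rewrite [mu _](@product_measure1E _ _ _ _ _ (rV_lebesgue N.-1)
  (@lebesgue_measure R))//.
by apply: mule_pos_fin; [apply/andP|exact: lebesgue_ball_pos].
Qed.

(** An open set is the union of those balls with rational centre and radius 1/(k+1) that it
    contains, a countable family. *)
Lemma open_space_measurable (U : set RN) : open U -> measurable U.
Proof.
move=> oU.
pose q (p : 'rV[rat]_N.-1 * rat * nat) : RN := (map_mx ratr p.1.1, ratr p.1.2).
pose B p : set RN := ball (q p) p.2.+1%:R^-1.
have mB p : measurable (B p).
  by apply: (ball_space_measure _ _).1; rewrite invr_gt0.
rewrite (_ : U = \bigcup_p (if `[< B p `<=` U >] then B p else set0)); last first.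
  apply/seteqP; split => [x Ux|x [p _]]; last by case: asboolP => // /[apply].
  have /nbhs_ballP[e /= e0 xeU] := oU x Ux.
  (* Half of [e], because a point of the small ball is compared with [x] through the centre. *)
  have [k ke] : exists k : nat, k.+1%:R^-1 < e / 2.
    exists (Num.truncn (e / 2)^-1).
    by rewrite invf_plt ?posrE ?divr_gt0// truncnS_gt.
  have k0 : (0 : R) < k.+1%:R^-1 by rewrite invr_gt0.
  have rat_near (t : R) : exists s : rat, `|ratr s - t| < k.+1%:R^-1.
    have [|s] := @rat_in_itvoo R (t - k.+1%:R^-1) (t + k.+1%:R^-1).
      by rewrite ltrD2l gtrN.
    by rewrite in_itv/= -ltr_distl => Hs; exists s.
  have [s /= Hs] := choice rat_near.
  have xB : B (map_mx s x.1, s x.2, k) x.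
    split; last exact: Hs.
    by split => // i j; rewrite !mxE; exact: Hs.
  exists (map_mx s x.1, s x.2, k) => //.
  rewrite asboolT// => y By; apply: xeU.
  by apply: (ball_splitr (z := q (map_mx s x.1, s x.2, k)));
    apply: le_ball (ltW ke) _ _.
apply: countable_bigcupT_measurable; first exact: countableP.
by move=> p; case: ifP.
Qed.

Lemma continuous_space_measurable (f : RN -> R) D : continuous f ->
  measurable D -> measurable_fun D f.
Proof.
move=> cf mD; apply: measurable_funS measurableT _ _ => //.
apply: (measurability _ (RGenOInfty.measurableE R)) => _ [_ [x ->] <-].
rewrite setTI; apply: open_space_measurable.
by apply: open_comp => //; exact: interval_open.
Qed.
End space.

(** * Compactly supported C^1 functions *)

Section affine_derive.
Context {R : realType} {V : normedModType R}.
Implicit Types (f : V -> R) (x v : V).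

Lemma is_derive_line f x v (s : R) : derivable f (x + s *: v) v ->
  is_derive s 1 (fun t => f (x + t *: v)) ('D_v f (x + s *: v)).
Proof.
move=> df.
have E : (fun h : R => h^-1 *: (((fun t : R => f (x + t *: v)) \o shift s) (h *: 1)
    - f (x + s *: v))) =
  (fun h : R => h^-1 *: ((f \o shift (x + s *: v)) (h *: v) - f (x + s *: v))).
  apply/funext => h /=; congr (_ *: (f _ - _)).
  by rewrite [h *: 1]mulr1 scalerDl addrCA.
by split; rewrite /derivable /derive E.
Qed.

(** Only derivability in the direction [v] is assumed, so the quotient of the composite at step [t]
    is compared directly with that of [f] at step [a * t], along sequences tending to 0. *)
Lemma is_derive_affine f x v w (c a : R) : a != 0 -> derivable f (a *: x + w) v ->
  is_derive x v (fun y => c * f (a *: y + w)) (c * a * 'D_v f (a *: x + w)).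
Proof.
move=> a0 df.
suff H : (fun h : R => h^-1 *: (((fun y => c * f (a *: y + w)) \o shift x) (h *: v)
    - c * f (a *: x + w))) @ 0^' --> c * a * 'D_v f (a *: x + w).
  by split; [apply/cvg_ex; eexists; exact: H|exact: cvg_lim H].
apply/cvgr_dnbhsP => t [t0 tc].
have /cvgr_dnbhsP/(_ (fun n => a * t n)) : (fun h : R => h^-1 *:
   ((f \o shift (a *: x + w)) (h *: v) - f (a *: x + w))) @ 0^' -->
   'D_v f (a *: x + w) by exact: df.
have h1 : (forall n, a * t n != 0) /\ (a * t n @[n --> \oo] --> (0 : R)).
  split=> [n|]; first by rewrite mulf_neq0.
  by rewrite -[X in _ --> X](mulr0 a); apply: cvgM => //; exact: cvg_cst.
move=> /(_ h1) /(cvgM (cvg_cst (c * a))).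
apply: cvg_trans; apply: near_eq_cvg; apply: nearW => n /=.
rewrite (_ : a *: (t n *: v + x) + w = (a * t n) *: v + (a *: x + w)); last first.
  by rewrite scalerDr scalerA addrA.
move: (f _) (f _) => A B; have tn0 := t0 n.
rewrite [LHS](_ : _ = c * a * ((a * t n)^-1 * (B - A)))//.
rewrite [RHS](_ : _ = (t n)^-1 * (c * B - c * A))//.
by field; apply/andP.
Qed.
End affine_derive.

Section C1.
Context {R : realType} (N : nat).
Local Notation RN := ('rV[R]_N.-1 * R)%type.
Local Notation mu := (@space_lebesgue R N).
Local Notation half := (@half_space R N).
Implicit Types (f g : RN -> R) (K : set RN).

(** Weaker than prescribing the support: one compact [K] serves a function, its partial derivatives
    and its products. *)
Definition vanishes_off K f := forall x, ~ K x -> f x = 0.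

Lemma Ck1P f : Ck 1 f <-> [/\ continuous f,
  (forall i x, derivable f x (coord_dir i)) & (forall i, continuous (partial i f))].
Proof.
split=> [[cf H]|[cf H1 H2]].
  by split=> // i; have [? [? _]] := H i.
by split=> // i; split=> //; split.
Qed.

Lemma Ck1M f g : Ck 1 f -> Ck 1 g -> Ck 1 (fun x => f x * g x) /\
  forall i x, partial i (fun x => f x * g x) x =
    f x * partial i g x + g x * partial i f x.
Proof.
move=> /Ck1P[cf df pf] /Ck1P[cg dg pg].
have E i x : partial i (fun x => f x * g x) x =
    f x * partial i g x + g x * partial i f x.
  by rewrite /partial (@deriveM _ _ f g).
split=> //; apply/Ck1P; split.
- by move=> x; apply: cvgM; [exact: cf|exact: cg].
- by move=> i x; exact: (@derivableM _ _ f g).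
- move=> i; have -> : partial i (fun x => f x * g x) =
    (fun x => f x * partial i g x + g x * partial i f x) by exact/funext.
  by move=> x; apply: cvgD; apply: cvgM; [exact: cf|exact: pg|exact: cg|exact: pf].
Qed.

(** The complement of [K] is open, so [f] is zero near each of its points. *)
Lemma vanishes_off_partial K f i : compact K -> vanishes_off K f ->
  vanishes_off K (partial i f).
Proof.
move=> cK fK x Kx.
have oK : open (~` K).
  by apply: closed_openC; apply: compact_closed => //; exact: norm_hausdorff.
rewrite /partial -(@derive_cst R RN R 0 x (coord_dir i)).
apply: near_eq_derive.
near=> y; apply: fK; near: y; exact: open_nbhs_nbhs.
Unshelve. all: end_near. Qed.

Lemma vanishes_off_bounded K f : compact K -> continuous f -> vanishes_off K f ->
  exists2 M : R, 0 < M & forall x, `|f x| <= M.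
Proof.
move=> cK cf fK.
have : compact (f @` K).
  by apply: continuous_compact => //; exact: continuous_subspaceT.
move=> /compact_bounded /ex_strict_bound_gt0[M M0 fM].
exists M => // x; have [Kx|Kx] := pselect (K x); last by rewrite fK// normr0 ltW.
by apply: ltW; apply: fM; exists x.
Qed.

Lemma compact_sub_ball K : compact K ->
  exists2 M : R, 0 < M & forall x, K x -> `|x| < M.
Proof. by move=> /compact_bounded/ex_strict_bound_gt0[M M0 KM]; exists M. Qed.

Lemma ballN0E (x : RN) M : ball (0 : RN) M x <-> `|x| < M.
Proof. by rewrite -ball_normE /ball_/= sub0r normrN. Qed.

Lemma ball_integrable (D : set RN) (M C : R) : measurable D -> 0 < M ->
  mu.-integrable D (fun x => (C * \1_(ball (0 : RN) M) x)%:E).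
Proof.
move=> mD M0; have [mb /andP[_ boo]] := ball_space_measure (0 : RN) M0.
apply: (integrableS measurableT) => //.
under eq_fun do rewrite EFinM.
apply: integrableZl => //; apply/integrableP; split.
  exact/measurable_EFinP.
under eq_integral do rewrite gee0_abs ?lee_fin//.
by rewrite integral_indic// setIT.
Qed.

Lemma vanishes_off_integrable K f (D : set RN) : compact K -> continuous f ->
  vanishes_off K f -> measurable D -> mu.-integrable D (EFin \o f).
Proof.
move=> cK cf fK mD.
have [M M0 fM] := vanishes_off_bounded cK cf fK.
have [r r0 Kr] := compact_sub_ball cK.
apply: le_integrable (ball_integrable M mD r0) => //.
  by apply/measurable_EFinP; exact: continuous_space_measurable.
move=> x _ /=; rewrite lee_fin.
have [Kx|Kx] := pselect (K x); last by rewrite fK// normr0.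
by rewrite indicE mem_set ?mulr1 ?(gtr0_norm M0)//; exact/ballN0E/Kr.
Qed.

Lemma continuous_translate g (v : RN) : continuous g ->
  continuous (fun x : RN => g (x + v)).
Proof.
move=> cg x; apply: (@continuous_comp _ _ _ (fun y : RN => y + v) g); last exact: cg.
by apply: cvgD; [exact: cvg_id|exact: cvg_cst].
Qed.

Lemma vanishes_off_translate K g (v : RN) : vanishes_off K g ->
  vanishes_off ((fun x : RN => x - v) @` K) (fun x : RN => g (x + v)).
Proof.
move=> gK x Kx; apply: gK => Kxv; apply: Kx.
by exists (x + v); rewrite ?addrK.
Qed.

Lemma compact_translate K (v : RN) : compact K -> compact ((fun x : RN => x - v) @` K).
Proof.
move=> cK; apply: continuous_compact => //; apply: continuous_subspaceT => x.
by apply: cvgD; [exact: cvg_id|exact: cvg_cst].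
Qed.

Lemma diff_quot_le g i (M t : R) (x : RN) : 0 < t ->
  (forall y, derivable g y (coord_dir i)) -> (forall y, `|partial i g y| <= M) ->
  `|t^-1 * (g (x + t *: coord_dir i) - g x)| <= M.
Proof.
move=> t0 dg gM; pose phi (s : R) := g (x + s *: coord_dir i).
have dphi (s : R) : is_derive s (1 : R) phi (partial i g (x + s *: coord_dir i)).
  by apply: is_derive_line; exact: dg.
have cphi : {within `[0, t], continuous phi}.
  by apply: derivable_within_continuous => s _; exact: ex_derive.
have [c _] := MVT t0 (fun s _ => dphi s) cphi.
by rewrite /phi scale0r addr0 subr0 => ->; rewrite mulrC mulfK ?gt_eqF.
Qed.

(** Steps along a sequence, as dominated convergence requires; [h n <= 1] keeps all the shifted
    supports in one ball. *)
Let h (n : nat) : R := n.+1%:R^-1.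
Let h_gt0 n : 0 < h n. Proof. by rewrite invr_gt0. Qed.

(** Dominated convergence: the mean value theorem bounds the quotients by a bound [M] of the partial
    derivative, and they vanish outside the ball of radius [r + |e|], where [r] bounds [K] and [e]
    is the direction. *)
Lemma cvg_integral_diff_quot K g i (D : set RN) :
  compact K -> Ck 1 g -> vanishes_off K g -> measurable D ->
  (\int[mu]_(x in D) ((h n)^-1 * (g (x + h n *: coord_dir i) - g x))%:E
     @[n --> \oo] --> \int[mu]_(x in D) (partial i g x)%:E)%E.
Proof.
move=> cK /Ck1P[cg dg pg] gK mD; set e := coord_dir i.
have [M M0 gM] := vanishes_off_bounded cK (pg i) (vanishes_off_partial i cK gK).
have [r r0 Kr] := compact_sub_ball cK.
have re0 : 0 < r + `|e| by rewrite ltr_pwDl.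
have mq n : measurable_fun D
    (fun x => ((h n)^-1 * (g (x + h n *: e) - g x))%:E).
  apply/measurable_EFinP; apply: measurable_funM => //.
  apply: measurable_funB; apply: continuous_space_measurable => //.
  exact: continuous_translate.
have mp : measurable_fun D (fun x => (partial i g x)%:E).
  by apply/measurable_EFinP; exact: continuous_space_measurable.
have [] // := dominated_convergence (mu := mu) mD mq mp _
  (ball_integrable M mD re0) _.
- apply: aeW => x _; apply: cvg_EFin; first exact: nearW.
  have /cvgr_dnbhsP/(_ h) : (fun t : R => t^-1 *: ((g \o shift x) (t *: e)
    - g x)) @ 0^' --> 'D_e g x by exact: dg.
  have hh : (forall n, h n != 0) /\ (h n @[n --> \oo] --> (0 : R)).
    by split=> [n|]; [rewrite gt_eqF|exact: cvg_harmonic].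
  move=> /(_ hh); apply: cvg_trans; apply: near_eq_cvg; apply: nearW => n /=.
  by rewrite [X in g X]addrC.
- apply: aeW => x n _; rewrite lee_fin.
  have [xr|xr] := ltP `|x| (r + `|e|).
    rewrite indicE mem_set ?mulr1; last exact/ballN0E.
    exact: diff_quot_le.
  have nKx : ~ K x by move/Kr; apply/negP; rewrite -leNgt (le_trans _ xr)// lerDl.
  rewrite (gK x)// (gK (x + h n *: e)).
    by rewrite subr0 mulr0 normr0 mulr_ge0// ltW.
  move/Kr; apply/negP; rewrite -leNgt.
  have := lerB_normD x (h n *: e); apply: le_trans.
  rewrite lerBrDr (le_trans _ xr)// lerD2l normrZ gtr0_norm//.
  by rewrite ler_piMl// invf_le1// ler1n.
Qed.

Lemma integral_diff_quot K g v t (D : set RN) :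
  compact K -> continuous g -> vanishes_off K g -> measurable D ->
  (\int[mu]_(x in D) (t * (g (x + v) - g x))%:E =
   t%:E * (\int[mu]_(x in D) (g (x + v))%:E - \int[mu]_(x in D) (g x)%:E))%E.
Proof.
move=> cK cg gK mD.
have ig := vanishes_off_integrable cK cg gK mD.
have igv := vanishes_off_integrable (compact_translate (v := v) cK)
  (continuous_translate (v := v) cg) (vanishes_off_translate (v := v) gK) mD.
under eq_integral do rewrite EFinM EFinB.
by rewrite integralZl//; [rewrite integralB|exact: integrableB].
Qed.

(* Translating along [coord_dir i] preserves [D], hence the integral. *)
Lemma integral_partial_eq0 K g i (D : set RN) :
  compact K -> Ck 1 g -> vanishes_off K g -> measurable D ->
  (forall (t : R) x, D (x + t *: coord_dir i) <-> D x) ->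
  (\int[mu]_(x in D) (partial i g x)%:E = 0)%E.
Proof.
move=> cK g1 gK mD De.
have [cg _ _] := (Ck1P g).1 g1.
have := cvg_integral_diff_quot (i := i) cK g1 gK mD.
under eq_fun do rewrite (integral_diff_quot _ _ cK)//.
have E n : (\int[mu]_(x in D) (g (x + h n *: coord_dir i))%:E =
            \int[mu]_(x in D) (g x)%:E)%E.
  rewrite -[RHS](integral_scales1 (scales_translation (h n *: coord_dir i)))//.
    rewrite (_ : _ @^-1` D = D)//; apply/seteqP.
    by split=> x /=; [move/(De (h n) x)|move=> Dx; exact/(De (h n) x)].
  by apply/measurable_EFinP; exact: continuous_space_measurable.
have ig := vanishes_off_integrable cK cg gK mD.
under eq_fun do rewrite E subee ?integrable_fin_num// mule0.
by move=> H; apply: (cvg_unique _ H); first exact: ereal_hausdorff; exact: cvg_cst.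
Qed.

(** The integral of [g (x + v)] over the half-space is that of [g] over the smaller set where [x_N]
    exceeds [h n]. As [g >= 0], every difference quotient has nonpositive integral. *)
Lemma integral_half_partial_le0 K g :
  compact K -> Ck 1 g -> vanishes_off K g -> (forall x, half x -> 0 <= g x) ->
  (\int[mu]_(x in half) (partial None g x)%:E <= 0)%E.
Proof.
move=> cK g1 gK g0.
have mD := @measurable_half_space R N.
have [cg _ _] := (Ck1P g).1 g1.
have := cvg_integral_diff_quot (i := None) cK g1 gK mD.
under eq_fun do rewrite (integral_diff_quot _ _ cK)//.
have ig D (mD' : measurable D) := vanishes_off_integrable cK cg gK mD'.
move=> H; apply: (cvge_to_le H).
apply: nearW => n /=.
set v : RN := h n *: coord_dir None.
have mHn : measurable [set x : RN | half (x - v)].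
  by have [+ _] := scales_translation (- v); move/(_ measurableT _ mD);
    rewrite setTI.
apply: mule_ge0_le0; first by rewrite lee_fin ltW// invr_gt0.
rewrite sube_le0.
have -> : (\int[mu]_(x in half) (g (x + v))%:E =
           \int[mu]_(x in [set x : RN | half (x - v)%R]) (g x)%:E)%E.
  rewrite -[RHS](integral_scales1 (scales_translation v))//.
    by congr (integral _ _ _); apply/seteqP; split => x /=; rewrite addrK.
  by apply/measurable_EFinP; exact: continuous_space_measurable.
apply: ge0_subset_integral => //.
  by apply/measurable_EFinP; exact: continuous_space_measurable.
move=> x /=; rewrite /half_space/= => xn.
rewrite (lt_le_trans xn)// gerBl.
by change (0 <= h n * 1); rewrite mulr1 ltW.
Qed.

End C1.

(** * Hardy's inequality on the half-space *)

Section coordinates.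
Context {R : realType} (N : nat).
Local Notation RN := ('rV[R]_N.-1 * R)%type.

Definition coordinate (i : option 'I_N.-1) (x : RN) : R :=
  if i is Some j then x.1 ord0 j else x.2.

Lemma continuous_bigsum (I : Type) (s : seq I) (F : I -> RN -> R) :
  (forall i, continuous (F i)) -> continuous (fun x => \sum_(i <- s) F i x).
Proof.
move=> cF; elim: s => [|i s IH].
  by under eq_fun do rewrite big_nil; move=> x; exact: cvg_cst.
under eq_fun do rewrite big_cons.
by move=> x; apply: cvgD; [exact: cF|exact: IH].
Qed.

Lemma coordinateD i x y : coordinate i (x + y) = coordinate i x + coordinate i y.
Proof. by case: i => [j|] //=; rewrite mxE. Qed.

Lemma coordinateZ i a x : coordinate i (a *: x) = a * coordinate i x.
Proof. by case: i => [j|] //=; rewrite mxE. Qed.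

Lemma coordinate_dirE i j : coordinate i (coord_dir j) = (i == j)%:R.
Proof.
case: i j => [i|] [j|] //=; last by rewrite mxE.
by rewrite mxE eqxx /= (inj_eq (Some_inj)).
Qed.

Lemma continuous_coordinate i : continuous (coordinate i).
Proof.
case: i => [j|] x /=; last exact: cvg_snd.
by apply: (@continuous_comp _ _ _ fst (fun y : 'rV[R]_N.-1 => y ord0 j));
  [exact: cvg_fst|exact: coord_continuous].
Qed.

Lemma is_derive_coordinate i x v : is_derive x v (coordinate i) (coordinate i v).
Proof.
have H : (fun h : R =>
    h^-1 *: ((coordinate i \o shift x) (h *: v) - coordinate i x)) @ 0^' -->
    coordinate i v.
  have : (fun _ : R => coordinate i v) @ 0^' --> coordinate i v by exact: cvg_cst.
  apply: cvg_trans; apply: near_eq_cvg; near=> h => /=.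
  rewrite coordinateD coordinateZ addrK /GRing.scale/= mulrA mulVf ?mul1r//.
  by near: h; exact: nbhs_dnbhs_neq.
by split; [apply/cvg_ex; exists (coordinate i v)|exact: cvg_lim H].
Unshelve. all: end_near. Qed.

Lemma Ck1_coordinate i : Ck 1 (coordinate i) /\
  forall j x, partial j (coordinate i) x = (i == j)%:R.
Proof.
have E j x : partial j (coordinate i) x = (i == j)%:R.
  rewrite /partial (derive_val (is_derive := is_derive_coordinate i x _)).
  exact: coordinate_dirE.
split=> //; apply/Ck1P; split.
- exact: continuous_coordinate.
- by move=> j x; have [] := is_derive_coordinate i x (coord_dir j).
- move=> j; rewrite (_ : partial j (coordinate i) = fun=> (i == j)%:R); last exact/funext.
  by move=> x; exact: cvg_cst.
Qed.

(** Built on the Euclidean norm, which unlike the sup norm of [RN] has a smooth square. *)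
Definition sqnorm1 (x : RN) : R := 1 + \sum_i coordinate i x ^+ 2.

Lemma sqnorm1_ge1 x : 1 <= sqnorm1 x.
Proof. by rewrite lerDl sumr_ge0// => i _; rewrite sqr_ge0. Qed.

Lemma sqnorm1_gt0 x : 0 < sqnorm1 x.
Proof. exact: lt_le_trans (sqnorm1_ge1 x). Qed.

(** Only the [i]-th coordinate moves, so for [h != 0] the difference quotient is exactly
    [2 * coordinate i x + h]. *)
Lemma Ck1_sqnorm1 : Ck 1 sqnorm1 /\
  forall i x, partial i sqnorm1 x = 2 * coordinate i x.
Proof.
have H i x : is_derive x (coord_dir i) sqnorm1 (2 * coordinate i x).
  have H : (fun h : R => h^-1 *: ((sqnorm1 \o shift x) (h *: coord_dir i) - sqnorm1 x))
      @ 0^' --> 2 * coordinate i x.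
    have : (fun h : R => 2 * coordinate i x + h) @ 0^' --> 2 * coordinate i x + 0.
      by apply: cvgD; [exact: cvg_cst|apply: cvg_within].
    rewrite addr0; apply: cvg_trans; apply: near_eq_cvg; near=> h => /=.
    have h0 : h != 0 by near: h; exact: nbhs_dnbhs_neq.
    rewrite /sqnorm1 (_ : \sum_j _ =
      \sum_j coordinate j x ^+ 2 + (2 * h * coordinate i x + h ^+ 2)).
      by rewrite /GRing.scale/=; field.
    rewrite [in LHS](bigD1 i)//= [in RHS](bigD1 i)//=.
    rewrite coordinateD coordinateZ coordinate_dirE eqxx mulr1.
    rewrite (eq_bigr (fun j => coordinate j x ^+ 2)); first by ring.
    move=> j ji; rewrite coordinateD coordinateZ coordinate_dirE (negbTE ji).
    by rewrite mulr0 add0r.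
  by split; [apply/cvg_ex; exists (2 * coordinate i x)|exact: cvg_lim H].
have E i x : partial i sqnorm1 x = 2 * coordinate i x.
  by rewrite /partial (derive_val (is_derive := H i x)).
split=> //; apply/Ck1P; split.
- move=> x; apply: cvgD; first exact: cvg_cst.
  apply: (continuous_bigsum (F := fun i x => coordinate i x ^+ 2)) => i y.
  exact: (cvgM (@continuous_coordinate i y) (@continuous_coordinate i y)).
- by move=> i x; have [] := H i x.
- move=> i.
  rewrite (_ : partial i sqnorm1 = fun x => 2 * coordinate i x); last exact/funext.
  by move=> x; apply: cvgM; [exact: cvg_cst|exact: continuous_coordinate].
Unshelve. all: end_near. Qed.

(** The classical Hardy weight, the inverse square of the Euclidean norm, regularised at the
    origin. *)
Definition hardy_weight (x : RN) : R := (sqnorm1 x)^-1.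

Lemma hardy_weight_gt0 x : 0 < hardy_weight x.
Proof. by rewrite invr_gt0 sqnorm1_gt0. Qed.

Lemma Ck1_hardy_weight : Ck 1 hardy_weight /\
  forall i x, partial i hardy_weight x = - 2 * coordinate i x * hardy_weight x ^+ 2.
Proof.
have [/Ck1P[cq dq pq] qE] := Ck1_sqnorm1.
have q0 x : sqnorm1 x != 0 by rewrite gt_eqF// sqnorm1_gt0.
have E i x : partial i hardy_weight x = - 2 * coordinate i x * hardy_weight x ^+ 2.
  rewrite /partial /hardy_weight (@deriveV _ _ sqnorm1)// -/(partial i sqnorm1 x) qE.
  by rewrite /GRing.scale/= exprVn; ring.
have cw : continuous hardy_weight by move=> x; apply: cvgV => //; exact: cq.
split; last exact: E.
apply/Ck1P; split; first exact: cw.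
- by move=> i x; apply: derivableV.
- move=> i; rewrite (_ : partial i hardy_weight =
    fun x => - 2 * coordinate i x * (hardy_weight x * hardy_weight x)).
    move=> x; apply: cvgM; apply: cvgM;
      [exact: cvg_cst|exact: continuous_coordinate|exact: cw|exact: cw].
  by apply/funext => x; rewrite E expr2.
Qed.

End coordinates.

Section test_functions.
Context {R : realType} (N : nat).
Local Notation RN := ('rV[R]_N.-1 * R)%type.
Local Notation mu := (@space_lebesgue R N).
Local Notation half := (@half_space R N).
Implicit Types (f phi : RN -> R).

Lemma test_functionP phi : test_function phi ->
  [/\ compact (closed_support phi), Ck 1 phi &
      vanishes_off (closed_support phi) phi].
Proof.
move=> [Cphi cphi]; split=> // x; apply: contra_notP => /eqP px.
exact: subset_closure.
Qed.

Lemma closed_support_min K f : compact K -> vanishes_off K f ->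
  closed_support f `<=` K.
Proof.
move=> cK fK; rewrite /closed_support.
have clK : closed K by apply: compact_closed => //; exact: norm_hausdorff.
rewrite [X in _ `<=` X](closure_id K).1//; apply: closure_subset => x /= fx.
by apply: contrapT => /fK /eqP; apply/negP.
Qed.

Lemma continuous_affine (a : R) (w : RN) : continuous (fun x : RN => a *: x + w).
Proof.
move=> x; apply: cvgD; last exact: cvg_cst.
by apply: cvgZ; [exact: cvg_cst|exact: cvg_id].
Qed.

Lemma partial_affine f i (c a : R) (w x : RN) : a != 0 ->
  derivable f (a *: x + w) (coord_dir i) ->
  derivable (fun y => c * f (a *: y + w)) x (coord_dir i) /\
  partial i (fun y => c * f (a *: y + w)) x = c * a * partial i f (a *: x + w).
Proof. by move=> a0 df; have [] := is_derive_affine c a0 df. Qed.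

(** The factor [c] is there for the induction: each derivative multiplies it by [a]. *)
Lemma Ck_affine k f (c a : R) (w : RN) : a != 0 -> Ck k f ->
  Ck k (fun y => c * f (a *: y + w)).
Proof.
move=> a0; elim: k f c => [|k IH] f c [cf df].
  split=> // x; apply: cvgM; first exact: cvg_cst.
  by apply: (@continuous_comp _ _ _ (fun x : RN => a *: x + w) f);
    [exact: continuous_affine|exact: cf].
split.
  move=> x; apply: cvgM; first exact: cvg_cst.
  by apply: (@continuous_comp _ _ _ (fun x : RN => a *: x + w) f);
    [exact: continuous_affine|exact: cf].
move=> i; have [dfi Cfi] := df i; split.
  by move=> x; apply: (partial_affine _ _ _).1.
rewrite (_ : partial i _ = fun x => c * a * partial i f (a *: x + w)).
  exact: IH.
by apply/funext => x; apply: (partial_affine _ _ _).2.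
Qed.

Lemma closed_support_affine phi (a : R) (w : RN) : a != 0 -> test_function phi ->
  compact (closed_support (fun y => phi (a *: y + w))) /\
  closed_support (fun y => phi (a *: y + w)) `<=`
    [set x | closed_support phi (a *: x + w)].
Proof.
move=> a0 tphi; have [cK _ phiK] := test_functionP tphi.
pose K := (fun y : RN => a^-1 *: (y - w)) @` closed_support phi.
have cK' : compact K.
  apply: continuous_compact => //; apply: continuous_subspaceT => x.
  apply: cvgZ; first exact: cvg_cst.
  by apply: cvgD; [exact: cvg_id|exact: cvg_cst].
have sK : closed_support (fun y => phi (a *: y + w)) `<=` K.
  apply: closed_support_min => // x Kx; apply: phiK => phix; apply: Kx.
  by exists (a *: x + w) => //; rewrite addrK scalerA mulVf ?scale1r.
split; first by apply: (subclosed_compact _ cK' sK); exact: closed_closure.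
by move=> x /sK[z Kz <-] /=; rewrite scalerA mulfV// scale1r subrK.
Qed.

Lemma test_function_affine phi (a : R) (w : RN) : a != 0 -> test_function phi ->
  test_function (fun y => phi (a *: y + w)).
Proof.
move=> a0 tphi; split=> [k|]; last exact: (closed_support_affine w a0 tphi).1.
have := Ck_affine 1 w a0 (tphi.1 k).
by under eq_fun do rewrite mul1r.
Qed.

(** With p = phi, w the weight and X the sum of the squared coordinates, the divergence is p^2 (N w
    - 2 w^2 X) plus cross terms. Young's inequality costs p^2 w^2 X / 2 and twice the squared
    gradient, whence 5/2. Since w X = 1 - w, what remains is at least (N - 5/2) p^2 w, and N >= 3
    leaves the factor 1/2. Integrated, 1/2 against 2 gives the constant 4 of [hardy]. *)
Lemma sum_partial_hardy phi (x : RN) (N_ge3 : (3 <= N)%N) : Ck 1 phi ->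
  1 / 2 * (phi x ^+ 2 * hardy_weight x) <= 2 * \sum_i partial i phi x ^+ 2 +
    \sum_i partial i (fun y => phi y * phi y * (coordinate i y * hardy_weight y)) x.
Proof.
move=> C1; have [C1w wE] := @Ck1_hardy_weight R N.
have [C2 E2] := Ck1M C1 C1.
set w := hardy_weight x; set p := phi x.
have Ei i : partial i (fun y => phi y * phi y * (coordinate i y * hardy_weight y)) x =
    p ^+ 2 * (w - 2 * coordinate i x ^+ 2 * w ^+ 2) +
    2 * p * partial i phi x * coordinate i x * w.
  have [C1x xE] := @Ck1_coordinate R N i; have [C3 E3] := Ck1M C1x C1w.
  have [_ E4] := Ck1M C2 C3; rewrite E4.
  by rewrite E2 E3 xE wE eqxx /= -/p -/w; ring.
have wS : w * \sum_i coordinate i x ^+ 2 = 1 - w.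
  have -> : \sum_i coordinate i x ^+ 2 = sqnorm1 x - 1.
    by rewrite /sqnorm1 addrC addrA addNr add0r.
  by rewrite mulrBr mulr1 mulVf// gt_eqF// sqnorm1_gt0.
have NE : \sum_(i : option 'I_N.-1) 1 = N%:R :> R.
  by rewrite sumr_const card_option card_ord prednK// (leq_trans _ N_ge3).
have w0 : 0 < w := hardy_weight_gt0 x.
have N3 : 3 <= N%:R :> R by rewrite ler_nat.
apply: (@le_trans _ _ (2 * \sum_i partial i phi x ^+ 2 +
   (p ^+ 2 * w * \sum_(i : option 'I_N.-1) 1 -
     5 / 2 * p ^+ 2 * w ^+ 2 * \sum_i coordinate i x ^+ 2
     - 2 * \sum_i partial i phi x ^+ 2))).
  rewrite NE addrC subrK expr2 !mulrA -(mulrA _ w (\sum_i _)) wS.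
  have pw0 : 0 <= p * p * w by apply: mulr_ge0; [rewrite -expr2 sqr_ge0|exact: ltW].
  have H1 : 0 <= p * p * w * w by apply: mulr_ge0 => //; exact: ltW.
  have H2 : 0 <= p * p * w * (N%:R - 3) by rewrite mulr_ge0// subr_ge0.
  nra.
rewrite lerD2l !mulr_sumr -!sumrB; apply: ler_sum => i _.
rewrite Ei.
have := sqr_ge0 (p * coordinate i x * w / 2 + partial i phi x); nra.
Qed.

Lemma energy1E (G : option 'I_N.-1 -> RN -> R) :
  energy (fun=> 1) G = (\int[mu]_(x in half) (\sum_i G i x ^+ 2)%:E)%E.
Proof. by apply: eq_integral => x _; rewrite mul1r. Qed.

Lemma continuous_sqr f : continuous f -> continuous (fun x => f x ^+ 2).
Proof. by move=> cf x; exact: (cvgM (cf x) (cf x)). Qed.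

Lemma integrable_sum_partial2 phi : test_function phi ->
  mu.-integrable half (fun x => (\sum_i partial i phi x ^+ 2)%:E).
Proof.
move=> /test_functionP[cK /Ck1P[_ _ pphi] phiK].
apply: (vanishes_off_integrable cK) => //; last exact: measurable_half_space.
  by apply: continuous_bigsum => i; exact: continuous_sqr.
move=> x Kx; rewrite big1// => i _.
by rewrite (vanishes_off_partial i cK phiK Kx) expr0n.
Qed.

(* Integrate the divergence of the vector field [phi ^ 2 * x / (1 + |x| ^ 2)],
   whose vertical component is nonnegative on the half-space. *)
Lemma hardy phi (N_ge3 : (3 <= N)%N) : test_function phi ->
  (\int[mu]_(x in half) (phi x ^+ 2 * hardy_weight x)%:E <=
   4%:E * energy (fun=> 1%R) (fun i x => partial i phi x))%E.
Proof.
move=> tphi; have [cK C1 phiK] := test_functionP tphi.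
have [/[dup] C1w /Ck1P[cw _ _] _] := @Ck1_hardy_weight R N.
have [cphi _ pphi] := (Ck1P phi).1 C1.
have mD := @measurable_half_space R N.
pose g i y := phi y * phi y * (coordinate i y * hardy_weight y).
have Cg i : Ck 1 (g i).
  by apply: (Ck1M (Ck1M C1 C1).1 (Ck1M (Ck1_coordinate i).1 C1w).1).1.
have gK i : vanishes_off (closed_support phi) (g i).
  by move=> x Kx; rewrite /g phiK// !mul0r.
have ig i : mu.-integrable half (fun x => (partial i (g i) x)%:E).
  apply: (vanishes_off_integrable cK) => //.
    by have /Ck1P[] := Cg i.
  exact: vanishes_off_partial.
have le0 i : (\int[mu]_(x in half) (partial i (g i) x)%:E <= 0)%E.
  case: i => [j|].
    rewrite (integral_partial_eq0 cK (Cg _) (gK _))// => t x.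
    by change (0 < x.2 + t * 0 <-> 0 < x.2); rewrite mulr0 addr0.
  apply: (integral_half_partial_le0 cK (Cg _) (gK _)) => x x0.
  apply: mulr_ge0; first by rewrite -expr2 sqr_ge0.
  by apply: mulr_ge0; apply: ltW => //; exact: hardy_weight_gt0.
have iw : mu.-integrable half (fun x => (phi x ^+ 2 * hardy_weight x)%:E).
  apply: (vanishes_off_integrable cK) => //.
    by move=> x; apply: cvgM; [exact: continuous_sqr|exact: cw].
  by move=> x Kx; rewrite phiK// expr0n mul0r.
have iS := integrable_sum_partial2 tphi.
have iP : mu.-integrable half (fun x => (\sum_i partial i (g i) x)%:E).
  by under eq_fun do rewrite -sumEFin; exact: integrable_sum.
have : (\int[mu]_(x in half) ((1 / 2)%:E * (phi x ^+ 2 * hardy_weight x)%:E) <=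
  \int[mu]_(x in half) (2%:E * (\sum_i partial i phi x ^+ 2)%:E +
    (\sum_i partial i (g i) x)%:E))%E.
  apply: (le_integral mD); first exact: (integrableZl mD).
    by apply: (integrableD mD) => //; exact: (integrableZl mD).
  by move=> x _; rewrite -!EFinM -EFinD lee_fin; exact: sum_partial_hardy.
rewrite integralZl// integralD//; last exact: (integrableZl mD).
rewrite integralZl//.
have P0 : (\int[mu]_(x in half) (\sum_i partial i (g i) x)%:E <= 0)%E.
  under eq_integral do rewrite -sumEFin.
  by rewrite integral_sum// sume_le0.
rewrite energy1E.
set A := (\int[mu]_(x in half) (phi x ^+ 2 * _)%:E)%E.
set B := (\int[mu]_(x in half) (\sum_i partial i phi x ^+ 2)%:E)%E.
have fA : A \is a fin_num by exact: integrable_fin_num.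
have fB : B \is a fin_num by exact: integrable_fin_num.
move=> /le_trans/(_ (leeD2l _ P0)); rewrite adde0.
rewrite -(fineK fA) -(fineK fB) -!EFinM !lee_fin; lra.
Qed.

End test_functions.

(** * Energies *)

(** Restricting to [e <= 1] lets the estimates absorb [e ^+ 2] into [e]. *)
Lemma ler_addgt0_scaled {R : realType} (a b c : R) :
  (forall e, 0 < e -> e <= 1 -> a <= b + e * c) -> a <= b.
Proof.
move=> H; rewrite leNgt; apply/negP => ba.
have c1 : 0 < `|c| + 1 by rewrite ltr_wpDl.
(* Makes [e * c] at most half of [a - b]; adding 1 avoids a division by 0. *)
pose e := Num.min 1 ((a - b) / (2 * (`|c| + 1))).
have e0 : 0 < e by rewrite lt_min ltr01 divr_gt0 ?subr_gt0 ?mulr_gt0.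
have /(H e e0) : e <= 1 by rewrite ge_min lexx.
have e2 : e * (2 * (`|c| + 1)) <= a - b.
  by rewrite -ler_pdivlMr ?mulr_gt0// ge_min lexx orbT.
have : e * c <= e * `|c| by rewrite ler_pM2l// ler_norm.
nra.
Qed.

Section energies.
Context {R : realType} (N : nat).
Local Notation RN := ('rV[R]_N.-1 * R)%type.
Local Notation mu := (@space_lebesgue R N).
Local Notation half := (@half_space R N).
Implicit Types (phi : RN -> R) (G : option 'I_N.-1 -> RN -> R) (rho : R -> R).

Definition measurable_weight rho := measurable_fun half (fun x : RN => rho x.2).

Lemma measurable_weight1 : measurable_weight (fun=> 1).
Proof. exact: measurable_cst. Qed.

Lemma measurable_energy rho G : measurable_weight rho ->
  (forall i, measurable_fun half (G i)) ->
  measurable_fun half (fun x => (rho x.2 * \sum_i G i x ^+ 2)%:E).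
Proof.
move=> mrho mG; apply/measurable_EFinP; apply: measurable_funM => //.
by apply: measurable_sum => i; exact: measurable_funX.
Qed.

Lemma sumsqr_ge0 G (x : RN) : 0 <= \sum_i G i x ^+ 2.
Proof. by apply: sumr_ge0 => i _; exact: sqr_ge0. Qed.

Lemma energy_ge0 rho G : (forall s, 0 < s -> 0 <= rho s) ->
  (0 <= energy rho G)%E.
Proof.
move=> rho0; apply: integral_ge0 => x x0; rewrite lee_fin mulr_ge0 ?sumsqr_ge0//.
exact: rho0.
Qed.

Lemma le_energy rho1 rho2 G1 G2 :
  measurable_weight rho1 -> measurable_weight rho2 ->
  (forall s, 0 < s -> 0 <= rho1 s) ->
  (forall i, measurable_fun half (G1 i)) -> (forall i, measurable_fun half (G2 i)) ->
  (forall x, half x ->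
     rho1 x.2 * \sum_i G1 i x ^+ 2 <= rho2 x.2 * \sum_i G2 i x ^+ 2) ->
  (energy rho1 G1 <= energy rho2 G2)%E.
Proof.
move=> m1 m2 rho0 mG1 mG2 le12; apply: ge0_le_integral.
- exact: measurable_half_space.
- by move=> x x0; rewrite lee_fin mulr_ge0 ?sumsqr_ge0//; exact: rho0.
- exact: measurable_energy.
- exact: measurable_energy.
- by move=> x x0; rewrite lee_fin; exact: le12.
Qed.

Lemma energyZ rho G (c : R) : 0 <= c -> measurable_weight rho ->
  (forall s, 0 < s -> 0 <= rho s) -> (forall i, measurable_fun half (G i)) ->
  energy (fun s => c * rho s) G = (c%:E * energy rho G)%E.
Proof.
move=> c0 mrho rho0 mG; rewrite /energy.
under eq_integral do rewrite -mulrA EFinM.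
rewrite ge0_integralZl_EFin//.
- exact: measurable_half_space.
- by move=> x x0; rewrite lee_fin mulr_ge0 ?sumsqr_ge0//; exact: rho0.
- exact: measurable_energy.
Qed.

(** The triangle inequality in Young's form, which integrates a pointwise bound and makes sense for
    infinite energies. *)
Lemma energy_triangle G1 G2 (e : R) : 0 < e ->
  (forall i, measurable_fun half (G1 i)) -> (forall i, measurable_fun half (G2 i)) ->
  (energy (fun=> 1%R) G1 <= (1 + e)%:E * energy (fun=> 1%R) G2 +
     (1 + e^-1)%:E * energy (fun=> 1%R) (fun i x => G1 i x - G2 i x)%R)%E.
Proof.
move=> e0 mG1 mG2.
have mG i : measurable_fun half (fun x => G1 i x - G2 i x).
  exact: measurable_funB.
have e1 : 0 <= 1 + e by rewrite addr_ge0// ltW.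
have e2 : 0 <= 1 + e^-1 by rewrite addr_ge0// invr_ge0 ltW.
have ge0 (c : R) G x : 0 <= c -> (0 <= (c * \sum_i G i x ^+ 2)%:E)%E.
  by move=> c0; rewrite lee_fin mulr_ge0// sumsqr_ge0.
have ms G (c : R) : (forall i, measurable_fun half (G i)) ->
    measurable_fun half (fun x : RN => (c * \sum_i G i x ^+ 2)%:E).
  by move=> mG'; apply: (measurable_energy (rho := fun=> c)) => //;
    exact: measurable_cst.
have mD := @measurable_half_space R N.
rewrite -!energyZ//; try exact: measurable_weight1.
rewrite /energy -ge0_integralD//; [|by move=> x _; rewrite mulr1; exact: ge0
  |by under eq_fun do rewrite mulr1; exact: ms
  |by move=> x _; rewrite mulr1; exact: (ge0 _ (fun i x => G1 i x - G2 i x))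
  |by under eq_fun do rewrite mulr1; exact: (ms (fun i x => G1 i x - G2 i x))].
apply: ge0_le_integral => //.
- by move=> x _; exact: ge0.
- exact: ms.
- apply: emeasurable_funD; under eq_fun do rewrite mulr1; first exact: ms.
  exact: (ms (fun i x => G1 i x - G2 i x)).
move=> x _; rewrite -EFinD lee_fin !mulr1 mul1r !mulr_sumr -big_split/=.
apply: ler_sum => i _; set a := G1 i x; set b := G2 i x.
have ei0 : 0 < e^-1 by rewrite invr_gt0.
have : 0 <= e^-1 * (e * b - (a - b)) ^+ 2
  by rewrite mulr_ge0 ?sqr_ge0// ltW.
have -> : e^-1 * (e * b - (a - b)) ^+ 2 = e * b ^+ 2 - 2 * b * (a - b)
    + e^-1 * (a - b) ^+ 2.
  by field; rewrite gt_eqF.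
nra.
Qed.

Lemma measurable_partial phi i : Ck 1 phi -> measurable_fun half (partial i phi).
Proof.
move=> /Ck1P[_ _ pphi]; apply: continuous_space_measurable => //.
exact: measurable_half_space.
Qed.

(** On the support, the height [x_N] is below the sup norm of [x], hence below [M]; off it the
    gradient is 0. *)
Lemma energy_test_bound rho phi (M C : R) : measurable_weight rho ->
  (forall s, 0 < s -> 0 <= rho s) -> (forall s, 0 < s -> s < M -> rho s <= C) ->
  (forall x, closed_support phi x -> `|x| < M) -> 0 < M -> test_function phi ->
  (energy rho (fun i => partial i phi) <=
   C%:E * energy (fun=> 1%R) (fun i => partial i phi))%E.
Proof.
move=> mrho rho0 rhoC KM M0 tphi; have [cK C1 phiK] := test_functionP tphi.
have mp i := measurable_partial i C1.
have C0 : 0 <= C.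
  have M2 : 0 < M / 2 by rewrite divr_gt0.
  apply: (le_trans (rho0 _ M2)); apply: rhoC => //.
  by rewrite ltr_pdivrMr// ltr_pMr// ltr1n.
rewrite -energyZ//; last exact: measurable_weight1.
apply: le_energy => //; first exact: measurable_cst.
move=> x x0; have [Kx|Kx] := pselect (closed_support phi x).
  rewrite mulr1; apply: ler_wpM2r; first exact: (sumsqr_ge0 (fun i => partial i phi)).
  apply: rhoC => //.
  apply: le_lt_trans (KM x Kx).
  by rewrite (le_trans (ler_norm _))// prod_normE/= le_max lexx orbT.
rewrite !big1 ?mulr0// => i _;
  by rewrite (vanishes_off_partial i cK phiK Kx) expr0n.
Qed.

Lemma energy_test_fin phi : test_function phi ->
  energy (fun=> 1) (fun i => partial i phi) \is a fin_num.
Proof.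
move=> tphi; rewrite energy1E.
apply: integrable_fin_num; first exact: measurable_half_space.
exact: integrable_sum_partial2.
Qed.

(** The gradient contributes [a ^+ 2] and the change of volume the rest, split into horizontal and
    vertical factors. The [+ 0] makes this an instance of the affine lemmas. *)
Lemma energy_dilation phi (a : R) : 0 < a -> test_function phi ->
  energy (fun=> 1) (fun i => partial i (fun x => phi (a *: x + 0))) =
  ((a ^+ 2 * (a ^- N.-1 * a^-1))%:E * energy (fun=> 1%R) (fun i => partial i phi))%E.
Proof.
move=> a0 tphi; have [cK C1 phiK] := test_functionP tphi.
have [_ dphi pphi] := (Ck1P phi).1 C1.
have mp i := measurable_partial i C1.
have an0 : a != 0 by rewrite gt_eqF.
have mD := @measurable_half_space R N.
have mST : measurable_fun [set: RN] (fun x => (\sum_i partial i phi x ^+ 2)%:E).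
  apply/measurable_EFinP; apply: continuous_space_measurable => //.
  by apply: continuous_bigsum => i; exact: continuous_sqr.
have mS : measurable_fun half (fun x => (\sum_i partial i phi x ^+ 2)%:E).
  exact: measurable_funTS.
have E i x : partial i (fun x => phi (a *: x + 0)) x = a * partial i phi (a *: x).
  have [_] := partial_affine 1 an0 (dphi i (a *: x + 0)).
  by under eq_fun do rewrite mul1r; rewrite mul1r addr0.
rewrite !energy1E.
rewrite EFinM -muleA -(ge0_integral_scales _ (scales_dilation N a0))//; last 2 first.
- by rewrite mulr_gt0 ?invr_gt0// exprn_gt0.
- by move=> x _; rewrite lee_fin; exact: (sumsqr_ge0 (fun i => partial i phi)).
have hE : (fun x : RN => a *: x) @^-1` half = half.
  by apply/seteqP; split => x; rewrite /half_space/=;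
    [rewrite pmulr_rgt0|rewrite pmulr_rgt0].
rewrite hE -ge0_integralZl_EFin//; last 3 first.
- by move=> x _; rewrite lee_fin; exact: (sumsqr_ge0 (fun i => partial i phi)).
- have [md _] := scales_dilation N a0.
  by apply: measurable_funTS; exact: (measurableT_comp mST md).
- exact: sqr_ge0.
apply: eq_integral => x _; rewrite -EFinM; congr EFin.
by rewrite mulr_sumr; apply: eq_bigr => i _; rewrite E exprMn.
Qed.
End energies.

(** * Boundary integrals *)

Section boundary.
Context {R : realType} (N : nat).
Hypothesis N_ge3 : (3 <= N)%N.
Local Notation RN := ('rV[R]_N.-1 * R)%type.
Local Notation mu := (@space_lebesgue R N).
Local Notation nu := (@rV_lebesgue R N.-1).
Local Notation half := (@half_space R N).
Local Notation p := (@trace_exponent R N).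
Implicit Types (phi : RN -> R) (T : 'rV[R]_N.-1 -> R).

Let N3 : 3 <= N%:R :> R. Proof. by rewrite ler_nat. Qed.

Lemma trace_exponent_ge1 : 1 <= p.
Proof. by rewrite /trace_exponent ler_pdivlMr; have := N3; lra. Qed.

Lemma trace_exponent_gt0 : 0 < p.
Proof. exact: lt_le_trans trace_exponent_ge1. Qed.

Let p_neq0 : p != 0. Proof. by rewrite gt_eqF// trace_exponent_gt0. Qed.

(** The identity behind the scale invariance: it equates the dilation exponents of the squared
    boundary norm and of the energy. *)
Lemma two_div_trace_exponent : 2 / p * (N.-1%:R) = N%:R - 2.
Proof.
have -> : N.-1%:R = N%:R - 1 :> R by rewrite -subn1 natrB// (leq_trans _ N_ge3).
rewrite /trace_exponent; have := N3; move=> ?.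
by field; rewrite !gt_eqF//; lra.
Qed.

Definition trace_norm T : \bar R := 'N[nu]_p%:E[EFin \o T]%E.

Lemma boundary_integralE T : boundary_integral T = (trace_norm T `^ p)%E.
Proof. by rewrite poweR_Lnorm. Qed.

Lemma boundary_integral_ge0 T : (0 <= boundary_integral T)%E.
Proof. by apply: integral_ge0 => x _; rewrite lee_fin powR_ge0. Qed.

Lemma trace_norm_ge0 T : (0 <= trace_norm T)%E.
Proof. exact: Lnorm_ge0. Qed.

(** Turns the denominator of the quotient into a squared norm, so that later estimates are
    polynomial in the norm. *)
Lemma boundary_integral_pow T :
  (boundary_integral T `^ (2 / p) = trace_norm T * trace_norm T)%E.
Proof.
rewrite boundary_integralE -poweRrM mulrC divfK//.
case: (trace_norm T) (trace_norm_ge0 T) => [r| |] //= r0.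
  by rewrite powR_mulrn.
by rewrite gt_eqF// mulyy.
Qed.

Lemma trace_norm_root T : trace_norm T = (boundary_integral T `^ p^-1)%E.
Proof. by rewrite boundary_integralE -poweRrM mulfV// poweRe1// trace_norm_ge0. Qed.

(** Minkowski's inequality, with the difference oriented as in [is_trace]: [T1] is the trace and
    [T2] an approximation. *)
Lemma trace_norm_triangle T1 T2 : measurable_fun [set: 'rV[R]_N.-1] T1 ->
  measurable_fun [set: 'rV[R]_N.-1] T2 ->
  (trace_norm T1 <= trace_norm T2 + trace_norm (fun x => T2 x - T1 x)%R)%E.
Proof.
move=> m1 m2.
have mD : measurable_fun [set: 'rV[R]_N.-1] (fun x => T1 x - T2 x).
  exact: measurable_funB.
have := minkowski_EFin nu m2 mD trace_exponent_ge1.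
rewrite (_ : T2 \+ _ = T1); last by apply/funext => x /=; rewrite addrC subrK.
move=> /le_trans; apply; rewrite leeD2l//.
rewrite /trace_norm -[leRHS]oppe_Lnorm le_eqVlt; apply/orP; left; apply/eqP.
by apply: eq_Lnorm => x; change ((T1 x - T2 x)%:E = (- (T2 x - T1 x))%:E); rewrite opprB.
Qed.

Lemma measurable_boundary phi : continuous phi ->
  measurable_fun [set: 'rV[R]_N.-1] (fun x => phi (x, 0)).
Proof.
move=> cphi; apply: (@measurableT_comp _ _ _ _ _ _ phi _ (fun x => (x, 0 : R))).
  exact: continuous_space_measurable.
by apply/measurable_fun_pairP; split; [exact: measurable_id|exact: measurable_cst].
Qed.

Lemma boundary_test_fin phi : test_function phi ->
  boundary_integral (fun x => phi (x, 0)) \is a fin_num.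
Proof.
move=> tphi; have [cK C1 phiK] := test_functionP tphi.
have [cphi _ _] := (Ck1P phi).1 C1.
have [M M0 phiM] := vanishes_off_bounded cK cphi phiK.
have [r r0 Kr] := compact_sub_ball cK.
have [mb /andP[_ boo]] := ball_rV_measure (0 : 'rV[R]_N.-1) r0.
rewrite ge0_fin_numE ?boundary_integral_ge0//.
apply: (@le_lt_trans _ _
    (\int[nu]_x ((M `^ p)%:E * (\1_(ball (0 : 'rV[R]_N.-1) r) x)%:E))%E).
  apply: ge0_le_integral; [by []|by move=> x _; rewrite lee_fin powR_ge0| | |].
  - apply/measurable_EFinP; apply: (measurableT_comp (measurable_powR _)).
    by apply: measurableT_comp => //; exact: measurable_boundary.
  - by apply: emeasurable_funM => //; exact/measurable_EFinP.
  move=> x _; rewrite -EFinM lee_fin indicE.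
  have [xr|xr] := boolP (x \in _).
    by rewrite mulr1 ge0_ler_powR ?nnegrE ?(ltW M0)// ltW// trace_exponent_gt0.
  rewrite mulr0 phiK ?normr0 ?powR0// => /Kr; move: xr; rewrite notin_setE => xr.
  rewrite prod_normE/= gt_max => /andP[xr' _]; apply: xr.
  by rewrite -ball_normE/= sub0r normrN.
rewrite ge0_integralZl_EFin ?powR_ge0//; last exact/measurable_EFinP.
by rewrite integral_indic// setIT lte_mul_pinfty// ?lee_fin ?powR_ge0.
Qed.

Lemma boundary_dilation phi (a : R) : 0 < a -> continuous phi ->
  boundary_integral (fun x => phi (a *: (x, 0) + 0)) =
  ((a ^- N.-1)%:E * boundary_integral (fun x => phi (x, 0%R)))%E.
Proof.
move=> a0 cphi.
have c0 : 0 < a ^- N.-1 by rewrite invr_gt0 exprn_gt0.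
have mg : measurable_fun [set: 'rV[R]_N.-1] (fun x => (`|phi (x, 0)| `^ p)%:E).
  apply/measurable_EFinP; apply: (measurableT_comp (measurable_powR _)).
  by apply: measurableT_comp => //; exact: measurable_boundary.
have g0 x : [set: 'rV[R]_N.-1] x -> (0 <= (`|phi (x, 0)%R| `^ p)%:E)%E.
  by rewrite lee_fin powR_ge0.
rewrite -(ge0_integral_scales c0 (scales_rV_lebesgue 0 a0) measurableT mg g0).
apply: eq_integral => x _.
by rewrite (_ : a *: (x, 0) + 0 = (a *: x + 0, 0))// addr0; congr pair;
  rewrite ?addr0//; exact: mulr0.
Qed.

Lemma near_neq0 phi z : continuous phi -> phi z != 0 ->
  exists2 e : R, 0 < e & forall y, ball z e y -> phi y != 0.
Proof.
move=> cphi pz; have /cvgrPdist_lt/(_ `|phi z|) := cphi z.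
rewrite normr_gt0 => /(_ pz) /nbhs_ballP[e /= e0 He]; exists e => // y /He /=.
by apply: contraTneq => ->; rewrite subr0 ltxx.
Qed.

(** A zero integral gives zero almost everywhere; a nonzero value would persist on a ball, which has
    positive measure. *)
Lemma boundary_eq0 phi : continuous phi ->
  boundary_integral (fun x => phi (x, 0)) = 0%E <-> (forall x, phi (x, 0) = 0).
Proof.
move=> cphi; split=> [b0 x|phi0]; last first.
  by apply: integral0_eq => x _; rewrite phi0 normr0 powR0.
have mphi := measurable_boundary cphi.
apply: contrapT => /eqP px.
have [e e0 He'] := near_neq0 cphi px.
have He y : ball x e y -> phi (y, 0) != 0.
  by move=> xy; apply: He'; split => //=; exact: ballxx.
have [mb /andP[b_gt0 _]] := ball_rV_measure x e0.
move: b0; rewrite /boundary_integral.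
under eq_integral do rewrite -(ger0_norm (powR_ge0 _ _)) -abse_EFin.
move/ae_eq_integral_abs => [//| |A [mA A0 sA]].
  apply/measurable_EFinP; apply: (measurableT_comp (measurable_powR _)).
  exact: measurableT_comp.
suff : (nu (ball x e) <= nu A)%E by rewrite A0 leNgt b_gt0.
apply: le_measure; rewrite ?inE// => y /He py; apply: sA => /= /(_ Logic.I).
by move=> /eqP; rewrite eqe powR_eq0 normr_eq0 (negbTE py).
Qed.

(** Shows that a test function with nonzero trace is a nonzero element. The point [(x, 0)] is
    outside the half-space, so the ball of positive measure is centred at height [e / 4] with radius
    [e / 4]: inside the half-space and within [e] of [(x, 0)]. *)
Lemma half_ae_eq0 phi x : continuous phi ->
  {ae mu, forall x, half x -> phi x = 0} -> phi (x, 0) = 0.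
Proof.
move=> cphi [A [mA A0 sA]].
apply: contrapT => /eqP px.
have [e e0 He] := near_neq0 cphi px.
have e40 : 0 < e / 4 by rewrite divr_gt0.
have [mb /andP[b_gt0 _]] := ball_space_measure (x, e / 4) e40.
suff : (mu (ball (x, (e / 4)%R) (e / 4)%R) <= mu A)%E by rewrite A0 leNgt b_gt0.
apply: le_measure; rewrite ?inE// => y xy; apply: sA => /= H.
have yh : half y.
  case: xy => _; rewrite /half_space /ball/= ltr_distlC => /andP[+ _].
  by rewrite subrr.
suff : phi y != 0 by rewrite H// eqxx.
have e42 : e / 4 < e / 2 by lra.
apply: He; apply: (@ball_splitr _ _ (x, e / 4)).
  by split; [apply: ballxx; rewrite divr_gt0|rewrite /ball/= subr0 gtr0_norm].
exact: le_ball (ltW e42) _ xy.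
Qed.
End boundary.

(** * Test functions as elements of D^{1,2} *)

Lemma cvge0_near {R : realType} (c : nat -> \bar R) (e : R) :
  c @ \oo --> 0%E -> 0 < e -> \forall k \near \oo, (c k <= e%:E)%E.
Proof.
move=> /fine_cvgP[cf /cvgrPdist_lt H] e0; near=> k.
have ck : c k \is a fin_num by near: k.
rewrite -(fineK ck) lee_fin (le_trans (ler_norm _))// -normrN -sub0r ltW//.
by near: k; exact: H.
Unshelve. all: end_near. Qed.

Section test_D12.
Context {R : realType} (N : nat).
Local Notation RN := ('rV[R]_N.-1 * R)%type.
Local Notation mu := (@space_lebesgue R N).
Local Notation half := (@half_space R N).
Implicit Types (phi : RN -> R) (K : set RN).

Lemma compact_space_measurable K : compact K -> measurable K.
Proof.
move=> cK; rewrite -(setCK K); apply: measurableC; apply: open_space_measurable.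
by apply: closed_openC; apply: compact_closed => //; exact: norm_hausdorff.
Qed.

Lemma vanishes_off_locally_integrable K f : compact K -> continuous f ->
  vanishes_off K f -> @locally_integrable_half R N f.
Proof.
move=> cK cf fK; split.
  by apply: continuous_space_measurable => //; exact: measurable_half_space.
move=> L cL _; have mL := compact_space_measurable cL.
have /integrableP[_] := vanishes_off_integrable cK cf fK mL.
by under eq_integral do rewrite abse_EFin.
Qed.

Lemma integral_vanishes_off_half f : vanishes_off half f ->
  (\int[mu]_(x in half) (f x)%:E = \int[mu]_x (f x)%:E)%E.
Proof.
move=> fh; rewrite integral_mkcond; apply: eq_integral => x _.
rewrite patchE; case: ifPn => //; rewrite notin_setE => xh.
by rewrite fh.
Qed.

Lemma vanishes_off_sub (A B : set RN) f : A `<=` B -> vanishes_off A f ->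
  vanishes_off B f.
Proof. by move=> AB fA x Bx; apply: fA => /AB. Qed.

(** [psi] is supported in the half-space, so the integrals extend to the whole space, which is
    invariant in every direction; there the derivative of [phi * psi] has integral 0. *)
Lemma test_weak_gradient phi : test_function phi ->
  weak_gradient phi (fun i => partial i phi).
Proof.
move=> tphi; have [cK C1 phiK] := test_functionP tphi.
have [cphi _ pphi] := (Ck1P phi).1 C1.
split.
- exact: vanishes_off_locally_integrable cK cphi phiK.
- move=> i; apply: (vanishes_off_locally_integrable cK (pphi i)).
  exact: vanishes_off_partial.
move=> i psi tpsi psih; have [cL D1 psiL] := test_functionP tpsi.
have [cpsi _ ppsi] := (Ck1P psi).1 D1.
have [CM ME] := Ck1M C1 D1.
have psih' := vanishes_off_sub psih psiL.
have ppsiL := vanishes_off_partial i cL psiL.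
have v1 : vanishes_off (closed_support psi) (fun x => phi x * partial i psi x).
  by move=> x Lx; rewrite ppsiL// mulr0.
have v2 : vanishes_off (closed_support psi) (fun x => partial i phi x * psi x).
  by move=> x Lx; rewrite psiL// mulr0.
have vM : vanishes_off (closed_support psi) (fun x => phi x * psi x).
  by move=> x Lx; rewrite psiL// mulr0.
rewrite !integral_vanishes_off_half;
  [|exact: vanishes_off_sub v2|exact: vanishes_off_sub v1].
have c1 : continuous (fun x => phi x * partial i psi x).
  by move=> x; apply: cvgM; [exact: cphi|exact: ppsi].
have c2 : continuous (fun x => partial i phi x * psi x).
  by move=> x; apply: cvgM; [exact: pphi|exact: cpsi].
have i1 := vanishes_off_integrable cL c1 v1 measurableT.
have i2 := vanishes_off_integrable cL c2 v2 measurableT.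
have := integral_partial_eq0 (i := i) cL CM vM measurableT (fun _ _ => iff_refl _).
under eq_integral do rewrite ME EFinD [X in (_ + X%:E)%E]mulrC.
rewrite integralD//.
set A := (\int[mu]_x (phi x * _)%:E)%E; set B := (\int[mu]_x (_ * psi x)%:E)%E.
have fA : A \is a fin_num by exact: integrable_fin_num i1.
have fB : B \is a fin_num by exact: integrable_fin_num i2.
by rewrite -(fineK fA) -(fineK fB) -EFinD -EFinN => -[/eqP]; rewrite addr_eq0 => /eqP ->.
Qed.

Lemma energy_eq0 rho (G : option 'I_N.-1 -> RN -> R) :
  (forall i x, G i x = 0) -> energy rho G = 0%E.
Proof.
move=> G0; apply: integral0_eq => x _.
by rewrite big1 ?mulr0// => i _; rewrite G0 expr0n.
Qed.

Lemma test_approximates rho phi : test_function phi ->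
  approximates rho (fun=> phi) phi (fun i => partial i phi).
Proof.
move=> tphi; split=> // [r|].
  have -> : (fun k : nat => \int[mu]_(x in half `&` [set x | (`|x| < r)%R])
      `|phi x - phi x|%:E)%E = cst 0%E.
    by apply/funext => k; apply: integral0_eq => x _; rewrite subrr normr0.
  exact: cvg_cst.
have -> : (fun k : nat =>
    energy rho (fun i x => partial i phi x - partial i phi x)) = cst 0%E.
  by apply/funext => k; apply: energy_eq0 => i x; rewrite subrr.
exact: cvg_cst.
Qed.

Definition test_D12 rho phi (tphi : test_function phi) : D12 N rho :=
  MkD12 (test_weak_gradient tphi)
    (ex_intro _ (fun=> phi) (test_approximates rho tphi)).

Section weight.
Hypothesis N_ge3 : (3 <= N)%N.
Local Notation p := (@trace_exponent R N).
Variable rho : R -> R.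
Hypothesis rho_ge0 : forall s, 0 < s -> 0 <= rho s.

Lemma test_is_trace phi (tphi : test_function phi) :
  is_trace (test_D12 rho tphi) (fun x => phi (x, 0)).
Proof.
have [_ C1 _] := test_functionP tphi; have [cphi _ _] := (Ck1P phi).1 C1.
split; first exact: measurable_boundary.
exists (fun=> phi); split; first exact: test_approximates.
have -> : (fun k : nat => boundary_integral (fun x => phi (x, 0) - phi (x, 0))) = cst 0%E.
  apply/funext => k; apply: integral0_eq => x _.
  by rewrite subrr normr0 powR0// gt_eqF// trace_exponent_gt0.
exact: cvg_cst.
Qed.

Lemma trace_constant_ge0 : (0 <= trace_constant N rho)%E.
Proof.
apply: le_ereal_inf_tmp => _ [u [T [_ _ ->]]]; rewrite /trace_quotient.
case: ifP => // _; rewrite mule_ge0 ?energy_ge0// inve_ge0.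
exact: poweR_ge0.
Qed.

(** Multiplying out the quotient covers zero traces too: in \bar R the product with 0 is 0, even if
    the constant is +oo. *)
Lemma trace_constant_test phi : test_function phi ->
  (trace_constant N rho * (boundary_integral (fun x => phi (x, 0%R)) `^ (2 / p)) <=
   energy rho (fun i => partial i phi))%E.
Proof.
move=> tphi; have [_ C1 _] := test_functionP tphi.
have [cphi _ _] := (Ck1P phi).1 C1.
set b := boundary_integral _.
have bfin : b \is a fin_num by exact: boundary_test_fin.
have p0 := trace_exponent_gt0 N_ge3 : 0 < p.
have [b0|b0] := eqVneq b 0%E.
  rewrite b0 poweR0r ?mule0 ?energy_ge0// gt_eqF// divr_gt0//.
have b_gt0 : (0 < b)%E by rewrite lt0e b0 boundary_integral_ge0.
have bp_gt0 := poweR_gt0 (2 / p) b_gt0.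
have bpfin := fin_num_poweR (2 / p) bfin.
rewrite -(fineK bpfin) -lee_pdivlMr ?fine_gt0 ?bp_gt0 -?ge0_fin_numE ?poweR_ge0//.
apply: ereal_inf_lbound; exists (test_D12 rho tphi), (fun x => phi (x, 0)); split.
- move=> H; case/eqP: b0; apply/(boundary_eq0 N_ge3 cphi) => x.
  exact: half_ae_eq0 H.
- exact: test_is_trace.
rewrite /trace_quotient -/b (negbTE b0) -[in RHS](fineK bpfin).
by rewrite inver gt_eqF// -lte_fin fineK.
Qed.
End weight.
End test_D12.

(** * Dilations *)

Section weighted.
Context {R : realType} (N : nat).
Hypothesis N_ge3 : (3 <= N)%N.
Local Notation RN := ('rV[R]_N.-1 * R)%type.
Local Notation mu := (@space_lebesgue R N).
Local Notation nu := (@rV_lebesgue R N.-1).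
Local Notation half := (@half_space R N).
Local Notation p := (@trace_exponent R N).
Implicit Types (phi : RN -> R) (T : 'rV[R]_N.-1 -> R).

Lemma dilation_exponents (a : R) : 0 < a ->
  (a ^- N.-1) `^ (2 / p) = a ^+ 2 * (a ^- N.-1 * a^-1).
Proof.
move=> a0; have N0 : (0 < N)%N by exact: leq_trans N_ge3.
have -> : a ^+ 2 * (a ^- N.-1 * a^-1) = a `^ (2 - N%:R).
  rewrite -invfM -exprSr prednK// -powR_mulrn ?ltW// -powR_mulrn ?ltW//.
  rewrite -powR_inv1 ?powR_ge0// -powRrM mulrN1 -powRD//.
  by apply/implyP => _; rewrite gt_eqF.
rewrite -powR_mulrn ?ltW// -powRN -powRrM mulNr mulrC.
by rewrite two_div_trace_exponent// opprB.
Qed.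

Section upper_bound.
Variables (rho : R -> R) (beta : R).
Hypotheses (beta_gt0 : 0 < beta) (mrho : @measurable_weight R N rho).
Hypothesis rho_ge0 : forall s, 0 < s -> 0 <= rho s.
Hypothesis rho_le : forall s, 0 < s -> rho s <= (1 + s) `^ beta.

(* The quotient of the unweighted problem is invariant under the dilations
   [phi (a x)], and [rho] is close to [1] on their supports when [a] is large. *)
Lemma trace_constant_energy1 phi : test_function phi ->
  (trace_constant N rho * (boundary_integral (fun x => phi (x, 0%R)) `^ (2 / p)) <=
   energy (fun=> 1%R) (fun i => partial i phi))%E.
Proof.
move=> tphi; have [cK C1 _] := test_functionP tphi.
have [cphi _ _] := (Ck1P phi).1 C1.
have [M M0 KM] := compact_sub_ball cK.
set s := trace_constant N rho; set b := boundary_integral _.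
have s0 : (0 <= s)%E by exact: trace_constant_ge0.
set E := energy _ _.
have Efin : E \is a fin_num by exact: energy_test_fin.
have H (e : R) : 0 < e -> (s * b `^ (2 / p) <= (1 + e)%:E * E)%E.
  (* Chosen so that [1 + t <= c] forces [rho t <= c ^ beta = 1 + e]. *)
  move=> e0; pose c := (1 + e) `^ beta^-1.
  have c1 : 1 < c.
    apply: (@le_lt_trans _ _ (1 `^ beta^-1)); first by rewrite powR1.
    by rewrite gt0_ltr_powR ?invr_gt0// ?nnegrE ?ltrDl// addr_ge0// ltW.
  have cb : c `^ beta = 1 + e.
    rewrite -powRrM mulVf ?gt_eqF// powRr1//.
    by rewrite addr_ge0// ltW.
  (* After this dilation the support lies below height [M / a = c - 1]. *)
  pose a := M / (c - 1).
  have a0 : 0 < a by rewrite divr_gt0// subr_gt0.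
  have an0 : a != 0 by rewrite gt_eqF.
  have tpa := test_function_affine 0 an0 tphi.
  have := trace_constant_test N_ge3 rho_ge0 tpa.
  rewrite (boundary_dilation a0 cphi) poweRM ?boundary_integral_ge0//; last first.
    by rewrite lee_fin invr_ge0 exprn_ge0// ltW.
  rewrite -/b poweR_EFin dilation_exponents//.
  set d := a ^+ 2 * _.
  have d0 : 0 < d.
    apply: mulr_gt0; first exact: exprn_gt0.
    by apply: mulr_gt0; rewrite invr_gt0 ?exprn_gt0.
  have le2 : (energy rho (fun i => partial i (fun y => phi (a *: y + 0)%R)) <=
    (1 + e)%:E * energy (fun=> 1%R) (fun i => partial i (fun y => phi (a *: y + 0)%R)))%E.
    apply: (energy_test_bound (M := M / a)) => //.
    - move=> t t0 tM; apply: (le_trans (rho_le t0)).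
      rewrite -cb ge0_ler_powR ?nnegrE ?(ltW beta_gt0)//.
      + by rewrite addr_ge0// ltW.
      + exact: powR_ge0.
      rewrite -lerBrDl (le_trans (ltW tM))// /a invf_div mulrCA mulfV ?mulr1//.
      by rewrite gt_eqF.
    - move=> x /(closed_support_affine 0 an0 tphi).2 /= /KM.
      by rewrite addr0 normrZ gtr0_norm// ltr_pdivlMr// mulrC.
    - by rewrite divr_gt0.
  move=> /le_trans/(_ le2); rewrite (energy_dilation a0 tphi) -/d -/E.
  (* Both sides carry the same dilation factor [d], by [dilation_exponents]. *)
  rewrite muleCA [leRHS]muleCA lee_pmul2l//.
have sb0 : (0 <= s * b `^ (2 / p))%E by rewrite mule_ge0// poweR_ge0.
have sbfin : (s * b `^ (2 / p))%E \is a fin_num.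
  rewrite ge0_fin_numE// (le_lt_trans (H 1 ltr01))//.
  by rewrite -(fineK Efin) -EFinM ltry.
rewrite -(fineK Efin) -(fineK sbfin) lee_fin.
apply: (@ler_addgt0_scaled _ _ _ (fine E)) => e e0 _; rewrite -lee_fin (fineK sbfin).
by apply: (le_trans (H e e0)); rewrite -{1}(fineK Efin) -EFinM lee_fin mulrDl mul1r.
Qed.
End upper_bound.
End weighted.

(** * Limits of test functions *)

Section limits.
Context {R : realType} (N : nat).
Hypothesis N_ge3 : (3 <= N)%N.
Local Notation RN := ('rV[R]_N.-1 * R)%type.
Local Notation mu := (@space_lebesgue R N).
Local Notation half := (@half_space R N).
Local Notation p := (@trace_exponent R N).
Implicit Types (phi : nat -> RN -> R) (T : 'rV[R]_N.-1 -> R) (u : RN -> R)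
  (G : option 'I_N.-1 -> RN -> R).

Lemma trace_norm_test_fin f : test_function f ->
  trace_norm (fun x : 'rV[R]_N.-1 => f (x, 0)) \is a fin_num.
Proof.
by move=> tf; rewrite trace_norm_root// fin_num_poweR// boundary_test_fin.
Qed.

(** A single approximation whose distance to [T] is finite suffices, since the trace of a test
    function has finite norm. *)
Lemma trace_norm_fin phi T : measurable_fun [set: 'rV[R]_N.-1] T ->
  (forall k, test_function (phi k)) ->
  boundary_integral (fun x => phi k (x, 0) - T x) @[k --> \oo] --> 0%E ->
  trace_norm T \is a fin_num.
Proof.
move=> mT tphi cT; have [K _ HK] := cvge0_near cT ltr01.
have {}HK := HK K (leqnn K).
have [_ C1 _] := test_functionP (tphi K); have [cphi _ _] := (Ck1P _).1 C1.
rewrite ge0_fin_numE ?trace_norm_ge0//.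
apply: (le_lt_trans (trace_norm_triangle N_ge3 mT (measurable_boundary cphi))).
rewrite lte_add_pinfty//.
  by rewrite -ge0_fin_numE ?trace_norm_ge0// trace_norm_test_fin.
by rewrite trace_norm_root// poweR_lty// (le_lt_trans HK)// ltry.
Qed.

Lemma trace_limit (s : R) phi T G : 0 <= s ->
  measurable_fun [set: 'rV[R]_N.-1] T -> (forall i, measurable_fun half (G i)) ->
  (forall k, test_function (phi k)) ->
  energy (fun=> 1) (fun i x => partial i (phi k) x - G i x) @[k --> \oo] --> 0%E ->
  boundary_integral (fun x => phi k (x, 0) - T x) @[k --> \oo] --> 0%E ->
  (forall k, s%:E * (boundary_integral (fun x => phi k (x, 0%R)) `^ (2 / p)) <=
    energy (fun=> 1%R) (fun i => partial i (phi k)))%E ->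
  (s%:E * (boundary_integral T `^ (2 / p)) <= energy (fun=> 1%R) G)%E.
Proof.
move=> s0 mT mG tphi cG cT sE.
have Tfin := trace_norm_fin mT tphi cT.
set E := energy (fun=> 1) G.
have E0 : (0 <= E)%E by exact: energy_ge0.
have [->|Eoo] := eqVneq E +oo%E; first by rewrite leey.
have Efin : E \is a fin_num by rewrite ge0_fin_numE// ltey.
rewrite boundary_integral_pow// -(fineK Tfin) -(fineK Efin) -!EFinM lee_fin.
set n := fine _; set A := fine E.
have A0 : 0 <= A by exact: fine_ge0.
have n0 : 0 <= n by rewrite fine_ge0// trace_norm_ge0.
(* From [H2] and [H3], using [e ^+ 2 <= e]: (1 + e)((1 + e) A + 2 e) is at most A + e (3 A + 4), and
   the boundary error adds 2 s e. *)
apply: (@ler_addgt0_scaled _ _ _ (3 * A + 4 + 2 * s)) => e e0 e1.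
have p0 := trace_exponent_gt0 N_ge3 : 0 < p.
(* [e ^+ 2] compensates for the factor [1 + e^-1] of [energy_triangle]. *)
have [K1 _ HK1] := cvge0_near cG (exprn_gt0 2 e0).
have [K2 _ HK2] := cvge0_near cT (powR_gt0 p e0).
pose k := maxn K1 K2.
have {HK1} Gk := HK1 k (leq_maxl _ _); have {HK2} Tk := HK2 k (leq_maxr _ _).
have [_ C1 _] := test_functionP (tphi k); have [cphi _ _] := (Ck1P _).1 C1.
have dk : (trace_norm (fun x => phi k (x, 0) - T x)%R <= e%:E)%E.
  rewrite trace_norm_root//.
  rewrite (_ : e%:E = (e `^ p)%:E `^ p^-1)%E; last first.
    by rewrite poweR_EFin -powRrM mulfV ?gt_eqF// powRr1// ltW.
  apply: gt0_ler_poweR => //; first by rewrite invr_ge0 ltW.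
  - by rewrite in_itv/= boundary_integral_ge0 leey.
  - by rewrite in_itv/= lee_fin powR_ge0 leey.
have nkfin := trace_norm_test_fin (tphi k).
have Ekfin := energy_test_fin (tphi k).
set nk := fine (trace_norm (fun x => phi k (x, 0))).
set Ek := fine (energy (fun=> 1) (fun i => partial i (phi k))).
have nk0 : 0 <= nk by rewrite fine_ge0// trace_norm_ge0.
have Hn : n <= nk + e.
  rewrite -lee_fin EFinD !fineK//.
  apply: (le_trans (trace_norm_triangle N_ge3 mT (measurable_boundary cphi))).
  exact: leeD2l.
have HE : s * (nk * nk) <= Ek.
  have := sE k; rewrite boundary_integral_pow// -(fineK nkfin) -(fineK Ekfin).
  by rewrite -!EFinM lee_fin.
have HEk : Ek <= (1 + e) * A + (1 + e^-1) * e ^+ 2.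
  rewrite -lee_fin EFinD !EFinM !fineK//.
  apply: (le_trans (energy_triangle e0 (fun i => measurable_partial i C1) mG)).
  apply: leeD2l; apply: lee_wpmul2l => //.
  by rewrite lee_fin addr_ge0// invr_ge0 ltW.
have ee : (1 + e^-1) * e ^+ 2 = e ^+ 2 + e by field; rewrite gt_eqF.
rewrite ee in HEk.
have H1 : n * n <= (1 + e) * (nk * nk) + e ^+ 2 + e.
  apply: (@le_trans _ _ ((nk + e) * (nk + e))); first by rewrite ler_pM.
  (* The cross term satisfies 2 e nk <= e nk^2 + e. *)
  have := mulr_ge0 (ltW e0) (sqr_ge0 (nk - 1)); nra.
have e2e : e ^+ 2 <= e by rewrite expr2 ler_piMl// ltW.
have H2 : s * (n * n) <= (1 + e) * (s * (nk * nk)) + s * (2 * e).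
  apply: (le_trans (ler_wpM2l s0 H1)).
  have := ler_wpM2l s0 e2e; nra.
apply: (le_trans H2).
have H3 : (1 + e) * (s * (nk * nk)) <= (1 + e) * ((1 + e) * A + 2 * e).
  apply: ler_wpM2l; first by rewrite addr_ge0// ltW.
  apply: (le_trans HE); apply: (le_trans HEk); lra.
have H4 : e ^+ 2 * A <= e * A by rewrite ler_wpM2r.
nra.
Qed.

Lemma approximates_weaken (rho : R -> R) phi u G : @measurable_weight R N rho ->
  (forall s, 0 < s -> 1 <= rho s) -> (forall i, measurable_fun half (G i)) ->
  approximates rho phi u G -> approximates (fun=> 1) phi u G.
Proof.
move=> mrho rho1 mG [tphi cu cG]; split => //.
apply: (@squeeze_cvge _ _ _ _ (cst 0%E) _ _ _ _ _ cG); last exact: cvg_cst.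
apply: nearW => k; rewrite energy_ge0//=.
have [_ C1 _] := test_functionP (tphi k).
have mD i : measurable_fun half (fun x => partial i (phi k) x - G i x).
  by apply: measurable_funB => //; exact: measurable_partial.
apply: le_energy => //; first exact: measurable_weight1.
move=> x x0; apply: ler_wpM2r; last exact: rho1.
exact: (sumsqr_ge0 (fun i x => partial i (phi k) x - G i x)).
Qed.

Lemma ball_measurableE r : 0 < r -> measurable (half `&` [set x : RN | `|x| < r]).
Proof.
move=> r0; apply: measurableI; first exact: measurable_half_space.
have [+ _] := ball_space_measure (0 : RN) r0.
by rewrite (_ : ball _ _ = [set x : RN | `|x| < r])//; apply/seteqP; split => x /ballN0E.
Qed.

Lemma ae_eq0_half u : measurable_fun half u ->
  (forall r : R, 0 < r ->
    (\int[mu]_(x in half `&` [set x | (`|x| < r)%R]) `|u x|%:E = 0)%E) ->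
  {ae mu, forall x, half x -> u x = 0}.
Proof.
move=> mu_ u0.
pose D (n : nat) := half `&` [set x : RN | `|x| < n.+1%:R].
have H n : mu.-negligible (~` [set x | D n x -> u x = 0]).
  have n0 : 0 < n.+1%:R :> R by [].
  have mD := ball_measurableE n0.
  have := u0 _ n0; under eq_integral do rewrite -abse_EFin.
  move/(ae_eq_integral_abs mu mD) => [].
    apply/measurable_EFinP; apply: measurable_funS mu_ => //.
      exact: measurable_half_space.
  move=> A [mA A0 sA]; exists A; split => // x Hx; apply: sA => /= Hx'.
  by apply: Hx => /Hx' [].
have := negligible_bigcup H; apply: negligibleS => x /= /not_implyP[xh ux].
exists (Num.truncn `|x|) => //= H'; apply: ux; apply: H'; split => //=.
exact: truncnS_gt.
Qed.

(** By contradiction: every value of an approximation is a trace value of one of its vertical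
    translates, so if all these traces vanished, the approximations and their local L^1 limit [u]
    would vanish too. *)
Lemma exists_test_trace_neq0 (rho : R -> R) (u : D12 N rho) : D12_nonzero u ->
  exists2 psi : RN -> R, test_function psi &
    boundary_integral (fun x => psi (x, 0)) != 0%E.
Proof.
move=> nu; apply: contrapT => H; apply: nu.
have [[mu_ _] _ _] := D12_weak_gradient u.
have [phi [tphi cu _]] := D12_closure u.
have psi0 (psi : RN -> R) x : test_function psi -> psi (x, 0) = 0.
  move=> tpsi; have [_ C1 _] := test_functionP tpsi; have [cpsi _ _] := (Ck1P _).1 C1.
  apply: ((boundary_eq0 N_ge3 cpsi).1 _ x); apply: contrapT => /eqP b0.
  by apply: H; exists psi.
have phi0 k x : phi k x = 0.
  have := psi0 _ x.1 (test_function_affine (0, x.2) (oner_neq0 R) (tphi k)).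
  rewrite scale1r (_ : (x.1, 0) + (0, x.2) = x)//.
  by rewrite [RHS]surjective_pairing; congr pair; rewrite /= ?addr0 ?add0r.
apply: ae_eq0_half => // r r0.
have := cu r; rewrite (_ : (fun k => _) =
  cst (\int[mu]_(x in half `&` [set x | (`|x| < r)%R]) `|u x|%:E)%E).
  by move=> /(cvg_lim (@ereal_hausdorff R)) <-; rewrite lim_cst//; exact: ereal_hausdorff.
apply/funext => k; apply: eq_integral => x _.
by rewrite phi0 sub0r normrN.
Qed.

(** Each of the N coordinates is bounded by the sup norm. This turns the weighted Hardy bound into a
    local L^2 bound. *)
Lemma hardy_weight_lower r (x : RN) : 0 < r -> `|x| < r ->
  (1 + N%:R * r ^+ 2)^-1 <= hardy_weight x.
Proof.
move=> r0 xr.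
have Nr : 0 < 1 + N%:R * r ^+ 2 by rewrite ltr_pwDl// mulr_ge0// sqr_ge0.
rewrite lef_pV2 ?posrE ?sqnorm1_gt0// /sqnorm1 lerD2l.
have -> : N%:R * r ^+ 2 = \sum_(i : option 'I_N.-1) r ^+ 2.
  rewrite sumr_const card_option card_ord prednK ?mulr_natl//.
  exact: leq_trans N_ge3.
apply: ler_sum => i _; rewrite -(real_normK (num_real _)).
rewrite ler_sqr ?nnegrE ?(ltW r0)//; apply: le_trans (ltW xr).
rewrite prod_normE/= le_max; case: i => [j|]; apply/orP; [left|right] => //.
rewrite /coordinate/= /Num.norm/= mx_normrE.
exact: (le_bigmax _ (fun i : 'I_1 * 'I_N.-1 => `|x.1 i.1 i.2|) (ord0, j)).
Qed.

(** On a bounded set, |u| <= |phi_k - u| + |phi_k|, and |phi_k| <= e + |phi_k|^2 / e. Hardy bounds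
    the weighted square by a multiple of e^2 once the energy of phi_k is of order e^2, so every term
    is of order e. *)
Lemma D12_energy_eq0 phi u G : measurable_fun half u ->
  (forall i, measurable_fun half (G i)) ->
  approximates (fun=> 1) phi u G -> energy (fun=> 1) G = 0%E ->
  {ae mu, forall x, half x -> u x = 0}.
Proof.
move=> mu_ mG [tphi cu cG] G0; apply: ae_eq0_half => // r r0.
set B := half `&` _.
have mB : measurable B := ball_measurableE r0.
have Bfin : mu B \is a fin_num.
  have [mb /andP[_ boo]] := ball_space_measure (0 : RN) r0.
  rewrite ge0_fin_numE; last exact: measure_ge0.
  apply: le_lt_trans boo; apply: le_measure; [exact/mem_set|exact/mem_set|].
  by move=> x [_ /ballN0E].
pose w := (1 + N%:R * r ^+ 2)^-1 : R.
have w0 : 0 < w by rewrite invr_gt0 ltr_pwDl// mulr_ge0// sqr_ge0.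
pose m := fine (mu B).
have muB : measurable_fun B u.
  apply: measurable_funS mu_; first exact: measurable_half_space.
  exact: subIsetl.
have X0 : (0 <= \int[mu]_(x in B) `|u x|%:E)%E by exact: integral_ge0.
(* The three terms come from the L^1 error, from the constant [e] integrated over [B], and from
   Hardy's inequality (4 times the energy bound [2 * e ^+ 2]) divided by [e * w]. *)
suff H e : 0 < e -> (\int[mu]_(x in B) `|u x|%:E <= (e * (1 + m + 8 / w))%:E)%E.
  have Xfin : (\int[mu]_(x in B) `|u x|%:E)%E \is a fin_num.
    by rewrite ge0_fin_numE// (le_lt_trans (H 1 ltr01))// ltry.
  apply/eqP; rewrite eq_le X0 andbT -(fineK Xfin) lee_fin.
  apply: (@ler_addgt0_scaled _ _ _ (1 + m + 8 / w)) => e e0 _; rewrite add0r.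
  by rewrite -lee_fin fineK//; exact: H.
move=> e0.
have [K1 _ HK1] := cvge0_near cG (exprn_gt0 2 e0).
have [K2 _ HK2] := cvge0_near (cu r) e0.
pose k := maxn K1 K2.
have {HK1} Gk := HK1 k (leq_maxl _ _); have {HK2} uk := HK2 k (leq_maxr _ _).
have [_ C1 _] := test_functionP (tphi k); have [cphi _ _] := (Ck1P _).1 C1.
have Ek : (energy (fun=> 1%R) (fun i => partial i (phi k)) <= (2 * e ^+ 2)%:E)%E.
  apply: (le_trans (energy_triangle ltr01 (fun i => measurable_partial i C1) mG)).
  rewrite G0 mule0 add0e invr1 [leRHS]EFinM.
  by rewrite (_ : (1 + 1)%:E = 2%:E)// lee_wpmul2l.
have [/Ck1P[cw _ _] _] := @Ck1_hardy_weight R N.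
have cpw : continuous (fun x => phi k x ^+ 2 * hardy_weight x).
  by move=> x; apply: cvgM; [exact: continuous_sqr|exact: cw].
have mpw D : measurable D ->
    measurable_fun D (fun x => (phi k x ^+ 2 * hardy_weight x)%:E).
  by move=> mD; apply/measurable_EFinP; exact: continuous_space_measurable.
have mphi : measurable_fun B (phi k) by exact: continuous_space_measurable.
have pw0 x : (0 <= (phi k x ^+ 2 * hardy_weight x)%:E)%E.
  by rewrite lee_fin mulr_ge0 ?sqr_ge0// ltW// hardy_weight_gt0.
have Hk : (\int[mu]_(x in B) (phi k x ^+ 2 * hardy_weight x)%:E <= (8 * e ^+ 2)%:E)%E.
  apply: (@le_trans _ _ (\int[mu]_(x in half) (phi k x ^+ 2 * hardy_weight x)%:E)%E).
    apply: ge0_subset_integral => //; first exact: measurable_half_space.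
      by apply: mpw; exact: measurable_half_space.
    exact: subIsetl.
  apply: (le_trans (hardy N_ge3 (tphi k))).
  apply: (@le_trans _ _ (4%:E * (2 * e ^+ 2)%:E)%E); first by rewrite lee_wpmul2l.
  by rewrite -EFinM lee_fin mulrA; lra.
apply: (@le_trans _ _ (\int[mu]_(x in B) (`|phi k x - u x|%:E +
   (e%:E + (e * w)^-1%:E * (phi k x ^+ 2 * hardy_weight x)%:E)))%E).
  apply: ge0_le_integral => //.
  - by apply/measurable_EFinP; exact: measurableT_comp.
  - apply: emeasurable_funD.
      by apply/measurable_EFinP; apply: measurableT_comp => //; exact: measurable_funB.
    by apply: emeasurable_funD => //; apply: emeasurable_funM => //; exact: mpw.
  move=> x [_ xr]; rewrite -EFinM -!EFinD lee_fin.
  have := ler_distD (phi k x) 0 (u x).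
  rewrite !sub0r normrN (normrN (phi k x)) => Hd.
  rewrite (le_trans Hd)// [leLHS]addrC lerD2l.
  have Hw := hardy_weight_lower r0 xr.
  apply: (@le_trans _ _ (e + e^-1 * `|phi k x| ^+ 2)).
    have ei0 : 0 < e^-1 by rewrite invr_gt0.
    have : 0 <= e^-1 * (`|phi k x| - e) ^+ 2
      by rewrite mulr_ge0 ?sqr_ge0// ltW.
    have -> : e^-1 * (`|phi k x| - e) ^+ 2 = e^-1 * `|phi k x| ^+ 2 - 2 * `|phi k x| + e.
      by field; rewrite gt_eqF.
    have := normr_ge0 (phi k x); lra.
  rewrite lerD2l invfM -mulrA ler_wpM2l ?invr_ge0 ?(ltW e0)//.
  rewrite real_normK ?num_real// mulrCA ler_peMr ?sqr_ge0//.
  by rewrite ler_pdivlMl// mulr1.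
have ew0 : 0 <= (e * w)^-1 by rewrite invr_ge0 mulr_ge0// ltW.
rewrite ge0_integralD//; last 3 first.
- by apply/measurable_EFinP; apply: measurableT_comp => //; exact: measurable_funB.
- move=> x _; apply: adde_ge0; first by rewrite lee_fin ltW.
  by apply: mule_ge0; [rewrite lee_fin|exact: pw0].
- by apply: emeasurable_funD => //; apply: emeasurable_funM => //; exact: mpw.
rewrite ge0_integralD//; try by [move=> x _; rewrite lee_fin ltW
  |move=> x _; apply: mule_ge0; [rewrite lee_fin|exact: pw0]
  |apply: emeasurable_funM => //; exact: mpw].
rewrite integral_cst// ge0_integralZl_EFin//; last exact: mpw.
apply: (@le_trans _ _ (e%:E + (e%:E * m%:E + (e * w)^-1%:E * (8 * e ^+ 2)%:E))%E).
  apply: leeD => //; rewrite fineK//; apply: leeD => //.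
  by rewrite lee_wpmul2l.
rewrite -!EFinM -!EFinD lee_fin le_eqVlt; apply/orP; left; apply/eqP.
by rewrite /m; field; rewrite !gt_eqF.
Qed.
End limits.

(** * Comparison of the weighted and unweighted spaces *)

Section D12_facts.
Context {R : realType} (N : nat).
Hypothesis N_ge3 : (3 <= N)%N.
Local Notation half := (@half_space R N).
Local Notation mu := (@space_lebesgue R N).
Local Notation p := (@trace_exponent R N).

Lemma measurable_grad (rho : R -> R) (u : D12 N rho) i :
  measurable_fun half (D12_grad u i).
Proof. by have [_ /(_ i)[]] := D12_weak_gradient u. Qed.

(** The energy for [rho] is the unweighted one plus the one for [rho - 1]. Finiteness allows
    cancelling the former; the latter is then 0 with a positive weight, so [G] vanishes almost
    everywhere. *)
Lemma energy_gap (rho : R -> R) (G : option 'I_N.-1 -> 'rV[R]_N.-1 * R -> R) :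
  @measurable_weight R N rho -> (forall s, 0 < s -> 1 < rho s) ->
  (forall i, measurable_fun half (G i)) -> energy rho G \is a fin_num ->
  (energy rho G <= energy (fun=> 1%R) G)%E -> energy (fun=> 1) G = 0%E.
Proof.
move=> mrho rho1 mG Efin EE1.
have mD := @measurable_half_space R N.
have mrho1 : @measurable_weight R N (fun s => rho s - 1) by exact: measurable_funB.
have rho10 s (s0 : 0 < s) : 0 <= rho s - 1 by rewrite subr_ge0 ltW// rho1.
have gap0 : (0 <= energy (fun s => (rho s - 1)%R) G)%E by exact: energy_ge0.
have E1_ge0 : (0 <= energy (fun=> 1%R) G)%E by exact: energy_ge0.
have ED : (energy rho G = energy (fun=> 1%R) G + energy (fun s => (rho s - 1)%R) G)%E.
  rewrite /energy -ge0_integralD//.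
  - by apply: eq_integral => x _; rewrite -EFinD -mulrDl addrC subrK.
  - by move=> x x0; rewrite lee_fin mulr_ge0// sumsqr_ge0.
  - by apply: (measurable_energy (rho := fun=> 1)) => //; exact: measurable_weight1.
  - by move=> x x0; rewrite lee_fin mulr_ge0 ?rho10// sumsqr_ge0.
  - exact: (measurable_energy (rho := fun s => rho s - 1)).
have := Efin; rewrite ED fin_numD => /andP[E1fin gapfin].
have gap : energy (fun s => (rho s - 1)%R) G = 0%E.
  apply/eqP; rewrite eq_le gap0 andbT.
  move: EE1; rewrite ED -[leRHS]adde0 leeD2lE//.
have ae0 : ae_eq mu half (fun x => ((rho x.2 - 1) * \sum_i G i x ^+ 2)%:E) (cst 0%E).
  apply/ae_eq_integral_abs => //.
    exact: (measurable_energy (rho := fun s => rho s - 1)).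
  rewrite -[RHS]gap; apply: eq_integral => x /[!inE] x0.
  by rewrite gee0_abs// lee_fin mulr_ge0 ?rho10// sumsqr_ge0.
rewrite energy1E -[RHS](integral0 mu half).
apply: ge0_ae_eq_integral => //.
- apply/measurable_EFinP; apply: measurable_sum => i.
  by apply: measurable_funX; exact: mG.
- by move=> x _; rewrite lee_fin sumsqr_ge0.
apply: filterS ae0 => x H x0; have [/eqP] := H x0.
by rewrite mulf_eq0 subr_eq0 gt_eqF ?rho1//= => /eqP ->.
Qed.

Section weaken.
Variable rho : R -> R.
Hypotheses (mrho : @measurable_weight R N rho) (rho_ge1 : forall s, 0 < s -> 1 <= rho s).

Lemma D12_weaken_closure (u : D12 N rho) :
  exists phi, approximates (fun=> 1) phi u (D12_grad u).
Proof.
have [phi Hphi] := D12_closure u; exists phi.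
exact: approximates_weaken mrho rho_ge1 (measurable_grad u) Hphi.
Qed.

(** Function and gradient are the same terms, so [D12_nonzero u] also holds of the image by
    conversion. *)
Definition D12_weaken (u : D12 N rho) : D12 N (fun=> 1) :=
  MkD12 (D12_weak_gradient u) (D12_weaken_closure u).

Lemma D12_weaken_trace (u : D12 N rho) T : is_trace u T -> is_trace (D12_weaken u) T.
Proof.
move=> [mT [phi [Hphi bphi]]]; split => //; exists phi; split => //.
exact: approximates_weaken mrho rho_ge1 (measurable_grad u) Hphi.
Qed.

Lemma energy_weaken (u : D12 N rho) :
  (energy (fun=> 1%R) (D12_grad u) <= energy rho (D12_grad u))%E.
Proof.
apply: le_energy => //; [exact: measurable_weight1|exact: measurable_grad..|].
move=> x x0; apply: ler_wpM2r; last exact: rho_ge1.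
exact: (sumsqr_ge0 (D12_grad u)).
Qed.
End weaken.

Lemma is_trace_fin (rho : R -> R) (u : D12 N rho) T : is_trace u T ->
  boundary_integral T \is a fin_num.
Proof.
move=> [mT [phi [[tphi _ _] bphi]]].
by rewrite boundary_integralE// fin_num_poweR//; exact: trace_norm_fin bphi.
Qed.

Lemma trace_quotientE (rho : R -> R) (u : D12 N rho) T : is_trace u T ->
  boundary_integral T != 0%E ->
  0 < fine (boundary_integral T `^ (2 / p))%E /\
  trace_quotient u T =
    (energy rho (D12_grad u) * ((fine (boundary_integral T `^ (2 / p)))^-1)%:E)%E.
Proof.
move=> uT b0; have bfin := is_trace_fin uT.
have b_gt0 : (0 < boundary_integral T)%E by rewrite lt0e b0 boundary_integral_ge0.
have bp := poweR_gt0 (2 / p) b_gt0.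
have bpfin := fin_num_poweR (2 / p) bfin.
have fb0 : 0 < fine (boundary_integral T `^ (2 / p))%E by rewrite -lte_fin fineK.
split=> //; rewrite /trace_quotient (negbTE b0) -[in LHS](fineK bpfin).
by rewrite inver gt_eqF.
Qed.
End D12_facts.

Theorem theorem1p1 (R : realType) (N : nat) (rho : R -> R) (gamma beta : R)
    (N_ge3 : (3 <= N)%N)
    (rho_ge0 : forall s, 0 <= s -> 0 <= rho s)
    (rho_loc : locally_integrable `]0, +oo[ rho)
    (gamma_gt0 : 0 < gamma) (gamma_lt_beta : gamma < beta)
    (rho_bounds : forall s, 0 <= s ->
       (1 + s) `^ gamma <= rho s <= (1 + s) `^ beta) :
  trace_constant N rho = sobolev_trace_constant N /\
  forall (u : D12 N rho) (T : 'rV[R]_N.-1 -> R),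
    D12_nonzero u -> is_trace u T -> trace_quotient u T <> trace_constant N rho.
Proof.
have beta_gt0 : 0 < beta by exact: lt_trans gamma_lt_beta.
have rho_gt1 s : 0 < s -> 1 < rho s.
  move=> s0; have /andP[+ _] := rho_bounds s (ltW s0); apply: lt_le_trans.
  apply: (@le_lt_trans _ _ (1 `^ gamma)); first by rewrite powR1.
  by rewrite gt0_ltr_powR ?nnegrE ?ltrDl// addr_ge0// ltW.
have rho_ge1 s (s0 : 0 < s) := ltW (rho_gt1 s s0).
have rho0 s (s0 : 0 < s) := rho_ge0 s (ltW s0).
have rho_le s (s0 : 0 < s) : rho s <= (1 + s) `^ beta.
  by have /andP[] := rho_bounds s (ltW s0).
have mrho : @measurable_weight R N rho.
  have [mr _ _] := rho_loc.
  apply: (measurable_comp _ _ mr) => //.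
    by move=> _ [x x0 <-] /=; rewrite in_itv/= andbT.
  exact: measurable_funTS measurable_snd.
have test_le phi : test_function phi -> _ :=
  trace_constant_energy1 N_ge3 beta_gt0 mrho rho0 rho_le (phi := phi).
have S0 : (0 <= trace_constant N rho)%E by exact: trace_constant_ge0.
(* An infinite constant would give infinite energy to a test function of nonzero trace. The weight
   [sigma] is free because this serves elements of both spaces. *)
have Sfin (sigma : R -> R) (u : D12 N sigma) : D12_nonzero u ->
    trace_constant N rho \is a fin_num.
  move=> /(exists_test_trace_neq0 N_ge3)[psi tpsi b0].
  rewrite ge0_fin_numE// ltNge leye_eq; apply/negP => /eqP Soo.
  have := test_le psi tpsi; rewrite Soo gt0_mulye.
    by rewrite leye_eq => /eqP H; have := energy_test_fin tpsi; rewrite H.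
  by rewrite poweR_gt0// lt0e b0 boundary_integral_ge0.
have lower (u : D12 N (fun=> 1)) T : D12_nonzero u -> is_trace u T ->
    (trace_constant N rho <= trace_quotient u T)%E.
  move=> nu uT; have [b0|b0] := eqVneq (boundary_integral T) 0%E.
    by rewrite /trace_quotient b0 eqxx leey.
  have [fb0 ->] := trace_quotientE N_ge3 uT b0.
  have Sf := Sfin _ u nu.
  rewrite lee_pdivlMr// fineK; last by rewrite fin_num_poweR// (is_trace_fin N_ge3 uT).
  have [mT [phi [[tphi _ cG] cT]]] := uT.
  rewrite -(fineK Sf); apply: (trace_limit N_ge3 _ mT (measurable_grad u) tphi cG cT).
    exact: fine_ge0.
  by move=> k; rewrite (fineK Sf); exact: test_le.
have weaken_le (u : D12 N rho) T : is_trace u T ->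
    (trace_quotient (D12_weaken mrho rho_ge1 u) T <= trace_quotient u T)%E.
  move=> uT; rewrite /trace_quotient; case: ifP => // _.
  apply: lee_wpmul2r; first by rewrite inve_ge0 poweR_ge0.
  exact: (energy_weaken mrho rho_ge1 u).
split.
  apply/eqP; rewrite eq_le; apply/andP.
  split; apply: le_ereal_inf_tmp => _ [u [T [nu uT ->]]].
    exact: lower.
  apply: le_trans (weaken_le u T uT).
  apply: ereal_inf_lbound; exists (D12_weaken mrho rho_ge1 u), T.
  by split => //; exact: D12_weaken_trace.
move=> u T nu uT quot.
have Sf := Sfin _ u nu.
(* With zero trace the quotient is +oo, but the constant is finite. *)
have [b0|b0] := eqVneq (boundary_integral T) 0%E.
  by move: Sf; rewrite -quot /trace_quotient b0 eqxx.
pose v := D12_weaken mrho rho_ge1 u.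
have vT : is_trace v T by exact: D12_weaken_trace.
have [fb0 qu] := trace_quotientE N_ge3 uT b0.
have [_ qv] := trace_quotientE N_ge3 vT b0.
set E := energy rho (D12_grad u) in qu.
set E1 := energy (fun=> 1) (D12_grad u).
(* [u] attains the constant, which by [lower] is at most the unweighted quotient; the two quotients
   have the same denominator. *)
have EE1 : (E <= E1)%E.
  have := lower v T nu vT; rewrite -quot qu qv.
  by rewrite lee_pmul2r// lte_fin invr_gt0.
have Efin : E \is a fin_num.
  rewrite ge0_fin_numE; last exact: energy_ge0.
  rewrite ltNge leye_eq; apply/negP => /eqP Eoo.
  by move: Sf; rewrite -quot qu Eoo gt0_mulye// lte_fin invr_gt0.
apply: nu; have [phi Hphi] := D12_closure v.
apply: (D12_energy_eq0 N_ge3 _ (measurable_grad u) Hphi).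
  by have [[]] := D12_weak_gradient u.
exact: energy_gap mrho rho_gt1 (measurable_grad u) Efin EE1.
Qed.
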